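(* Let $K$ be a field and let $d \geq 1$ be an integer. For $g \in \mathbb{Z}_{\geq 0}$ let $S_g$ be the quiver with one vertex and $g$ loops, and let $TM_{S_g}(d)$ be the number of isomorphism classes of tree modules of dimension $d$ for $S_g$ over $K$. Then $TM_{S_g}(d)$, as a function of $g$, is a polynomial in $g$ of degree $d-1$. Furthermore, when written in the basis $\{\binom{g}{i} : 0 \leq i \leq d-1\}$ of $\bigoplus_{i=0}^{d-1} \mathbb{Q} g^i$, the polynomial $TM_{S_g}(d)$ has the same leading term as $A_{S_g}(d,1)$, namely $$\frac{2^{d-1}\,\#\mathscr{T}_d}{d}\binom{g}{d-1} = \sum_{Q \in \mathscr{Q}_d} \frac{(d-1)!}{\#\mathrm{Aut}(Q)} \binom{g}{d-1}.$$ Here $A_{S_g}(d,1)$ is the value at $q=1$ of the polynomial $A_{S_g}(d,q)$ counting isomorphism classes of $d$-dimensional absolutely indecomposable representations of $S_g$ over $\mathbb{F}_q$, $\mathscr{T}_d$ is the set of trees on $d$ labeled vertices, and $\mathscr{Q}_d$ is the set of isomorphism classes of tree quivers with $d$ (unlabeled) vertices.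
   Context: A quiver $Q=(Q_0,Q_1)$ has vertex set $Q_0$ and arrow set $Q_1$; $t\alpha$ and $h\alpha$ denote the tail and head of an arrow $\alpha$. A representation $V$ of $Q$ over $K$ assigns a $K$-vector space $V_x$ to each $x\in Q_0$ and a linear map $V_\alpha: V_{t\alpha}\to V_{h\alpha}$ to each $\alpha\in Q_1$; all representations are finite-dimensional, and the dimension is $\sum_{x} \dim V_x$. In particular a representation of $S_g$ is a finite-dimensional vector space with $g$ endomorphisms. A morphism of quivers $f: Q'\to Q$ is a map of vertices and of arrows that preserves heads and tails. The pushforward $f_*(V)$ of a representation $V$ of $Q'$ is the representation of $Q$ with $f_*(V)_x = \bigoplus_{y\in f^{-1}(x)} V_y$ for $x \in Q_0$ and $f_*(V)_\alpha = \sum_{\beta\in f^{-1}(\alpha)} V_\beta$ for $\alpha\in Q_1$, where each $V_\beta$ is extended by zero on $V_y$ for $y\neq t\beta$. A tree quiver is a finite quiver whose underlying graph is a tree (connected, no cycles). For a tree quiver $T$, $\mathbb{I}_T$ is the representation with $K$ at each vertex and the identity map at each arrow. An indecomposable representation $M$ of a quiver $Q$ is a tree module if there is a tree quiver $T$ and a quiver morphism $f:T\to Q$ with $M\simeq f_*(\mathbb{I}_T)$. $\mathrm{Aut}(Q)$ is the group of automorphisms of $Q$ as a directed graph. A representation over $\mathbb{F}_q$ is absolutely indecomposable if it is indecomposable after extension of scalars to an algebraic closure of $\mathbb{F}_q$. By a theorem of Kac, there is a polynomial $A_{S_g}(d,q)\in\mathbb{Z}[q]$ whose value at a prime power $q$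 (possibly excluding finitely many characteristics) is the number of isomorphism classes of $d$-dimensional absolutely indecomposable representations of $S_g$ over $\mathbb{F}_q$. By a known theorem of Helleloid and Rodriguez-Villegas, for fixed $d$ the number $A_{S_g}(d,1)$ is a polynomial in $g$ with leading term $\frac{2^{d-1}\#\mathscr{T}_d}{d!}g^{d-1}$; this may be used as a known result. (The number $\#\mathscr{T}_d$ equals $d^{d-2}$ by Cayley's theorem.) *)

(* Defs.v *)
From HB Require Import structures.
From mathcomp Require Import all_boot all_order all_fingroup all_algebra.

Set Implicit Arguments.
Unset Strict Implicit.
Unset Printing Implicit Defensive.

Import GRing.Theory Num.Theory.
Local Open Scope ring_scope.

(* [s] is a complete and irredundant system of representatives, up to the
   equivalence [iso], of the objects satisfying [P]. *)
Definition iso_representatives (T : Type) (P : T -> Prop) (iso : T -> T -> Prop)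
    (n : nat) (s : 'I_n -> T) : Prop :=
  [/\ forall i, P (s i),
      forall i j, iso (s i) (s j) -> i = j &
      forall V, P V -> exists i, iso V (s i)].

(* Relational, because the objects range over a large type: there are finitely
   many classes, and exactly [n] of them. *)
Definition iso_class_count (T : Type) (P : T -> Prop) (iso : T -> T -> Prop)
    (n : nat) : Prop :=
  exists s : 'I_n -> T, iso_representatives P iso s.

Record quiver := Quiver {
  vert : finType;
  arr : finType;
  qtail : arr -> vert;
  qhead : arr -> vert }.

Record quiver_hom (Q' Q : quiver) := QuiverHom {
  hom_vert : vert Q' -> vert Q;
  hom_arr : arr Q' -> arr Q;
  hom_tail : forall b, hom_vert (qtail b) = qtail (hom_arr b);
  hom_head : forall b, hom_vert (qhead b) = qhead (hom_arr b) }.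

Definition quiver_iso (Q Q' : quiver) : Prop :=
  exists f : quiver_hom Q Q', bijective (hom_vert f) /\ bijective (hom_arr f).

Definition quiver_Aut (Q : quiver) : {set {perm vert Q} * {perm arr Q}} :=
  [set s : {perm vert Q} * {perm arr Q} |
    [forall a, (qtail (s.2 a) == s.1 (qtail a)) && (qhead (s.2 a) == s.1 (qhead a))]].

Definition loop_quiver (g : nat) : quiver :=
  @Quiver unit 'I_g (fun=> tt) (fun=> tt).

Definition connected (T : finType) (e : rel T) : bool :=
  [forall x, forall y, connect e x y].

(* For [e] symmetric and irreflexive. The bound on the length is harmless, see
   [acyclicP]; [:: x; y] is always a [ucycle] when [e x y]. *)
Definition acyclic (T : finType) (e : rel T) : bool :=
  [forall n : 'I_#|T|.+1, forall p : n.-tuple T, ucycleb e p ==> (n <= 2)%N].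

Lemma acyclicP (T : finType) (e : rel T) :
  reflect (forall p : seq T, ucycle e p -> (size p <= 2)%N) (acyclic e).
Proof.
apply: (iffP forallP) => [H p ep | H n].
  have /andP[_ up] := ep.
  have szp : (size p < #|T|.+1)%N by rewrite ltnS -(card_uniqP up) max_card.
  have /forallP/(_ (in_tuple p))/implyP := H (Ordinal szp).
  exact.
by apply/forallP => p; apply/implyP => /H; rewrite size_tuple.
Qed.

(* For [e] symmetric and irreflexive, i.e. the adjacency relation of a simple
   graph. *)
Definition is_tree (T : finType) (e : rel T) : bool :=
  [&& (0 < #|T|)%N, connected e & acyclic e].

(* A graph on the vertices ['I_d] is given by its set of edges. *)
Definition labeled_trees (d : nat) : {set {set {set 'I_d}}} :=
  [set E : {set {set 'I_d}} |
    [forall e in E, #|e| == 2%N] && is_tree (fun x y => [set x; y] \in E)].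

Definition adjacent (Q : quiver) : rel (vert Q) :=
  fun x y => [exists a : arr Q,
    ((qtail a == x) && (qhead a == y)) || ((qtail a == y) && (qhead a == x))].

(* Loops and multiple arrows are cycles of the underlying graph. *)
Definition tree_quiver (Q : quiver) : Prop :=
  [/\ forall a : arr Q, qtail a != qhead a,
      forall a b : arr Q,
        [set qtail a; qhead a] = [set qtail b; qhead b] -> a = b &
      is_tree (@adjacent Q)].

Section DirectSum.
Variables (K : fieldType) (I : finType) (V : I -> vectType K).

Definition dsum : Type := {dffun forall i, V i}.
HB.instance Definition _ := Choice.on dsum.
Implicit Types u v w : dsum.

Definition dsum0 : dsum := [ffun i => 0 : V i].
Definition dsumN u : dsum := [ffun i => - u i : V i].
Definition dsumD u v : dsum := [ffun i => u i + v i : V i].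
Definition dsumZ (k : K) u : dsum := [ffun i => k *: u i : V i].

Fact dsumDA : associative dsumD.
Proof. by move=> u v w; apply/ffunP => i; rewrite !ffunE addrA. Qed.
Fact dsumDC : commutative dsumD.
Proof. by move=> u v; apply/ffunP => i; rewrite !ffunE addrC. Qed.
Fact dsum0D : left_id dsum0 dsumD.
Proof. by move=> u; apply/ffunP => i; rewrite !ffunE add0r. Qed.
Fact dsumND : left_inverse dsum0 dsumN dsumD.
Proof. by move=> u; apply/ffunP => i; rewrite !ffunE addNr. Qed.

HB.instance Definition _ :=
  GRing.isZmodule.Build dsum dsumDA dsumDC dsum0D dsumND.

Fact dsumZA a b u : dsumZ a (dsumZ b u) = dsumZ (a * b) u.
Proof. by apply/ffunP => i; rewrite !ffunE scalerA. Qed.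
Fact dsum1Z : left_id 1 dsumZ.
Proof. by move=> u; apply/ffunP => i; rewrite !ffunE scale1r. Qed.
Fact dsumZDr : right_distributive dsumZ +%R.
Proof. by move=> k u v; apply/ffunP => i; rewrite !ffunE scalerDr. Qed.
Fact dsumZDl u : {morph dsumZ^~ u : a b / a + b}.
Proof. by move=> a b; apply/ffunP => i; rewrite !ffunE scalerDl. Qed.

HB.instance Definition _ :=
  GRing.Zmodule_isLmodule.Build K dsum dsumZA dsum1Z dsumZDr dsumZDl.

Lemma dsum_addE u v i : (u + v) i = u i + v i. Proof. exact: ffunE. Qed.
Lemma dsum_scaleE (k : K) u i : (k *: u) i = k *: u i. Proof. exact: ffunE. Qed.

Let idx : finType := {i : I & 'I_(\dim {:V i})}.

Fact dsum_vect_iso : Vector.axiom #|idx| dsum.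
Proof.
pose b i := vbasis {:V i}.
pose f u : 'rV[K]_#|idx| :=
  \row_k coord (b (tag (enum_val k))) (tagged (enum_val k)) (u (tag (enum_val k))).
pose h (r : 'rV[K]_#|idx|) : dsum :=
  [ffun i => \sum_(j < \dim {:V i})
     r 0 (enum_rank (Tagged (fun i => 'I_(\dim {:V i})) j)) *: (b i)`_j].
exists f.
  move=> k u v; apply/rowP => j; rewrite !mxE dsum_addE dsum_scaleE.
  by rewrite linearP.
exists h => [u | r].
  apply/ffunP => i; rewrite ffunE [RHS](coord_vbasis (memvf (u i))).
  by apply: eq_bigr => j _; rewrite mxE enum_rankK.
apply/rowP => k; rewrite mxE ffunE coord_sum_free ?(basis_free (vbasisP _)) //.
by congr (r 0 _); rewrite -[RHS]enum_valK; congr enum_rank; case: (enum_val k).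
Qed.

HB.instance Definition _ := Lmodule_hasFinDim.Build K dsum dsum_vect_iso.

Definition dsum_proj_fun (i : I) (u : dsum) : V i := u i.
Definition dsum_inj_fun (i : I) (x : V i) : dsum :=
  [ffun j => dfwith (fun k => 0 : V k) x j : V j].

Fact dsum_proj_linear i : linear (dsum_proj_fun i).
Proof. by move=> k u v; rewrite /dsum_proj_fun dsum_addE dsum_scaleE. Qed.
HB.instance Definition _ i :=
  GRing.isLinear.Build K dsum (V i) _ (dsum_proj_fun i) (@dsum_proj_linear i).

Fact dsum_inj_linear i : linear (@dsum_inj_fun i).
Proof.
move=> k x y; apply/ffunP => j; rewrite dsum_addE dsum_scaleE !ffunE.
have [<- | ij] := eqVneq i j; first by rewrite !dfwith_in.
by rewrite !dfwith_out // scaler0 addr0.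
Qed.
HB.instance Definition _ i :=
  GRing.isLinear.Build K (V i) dsum _ (@dsum_inj_fun i) (@dsum_inj_linear i).

Definition dsum_proj i : 'Hom(dsum, V i) := linfun (dsum_proj_fun i).
Definition dsum_inj i : 'Hom(V i, dsum) := linfun (@dsum_inj_fun i).

End DirectSum.

Record rep (K : fieldType) (Q : quiver) := Rep {
  rvect : vert Q -> vectType K;
  rmap : forall a : arr Q, 'Hom(rvect (qtail a), rvect (qhead a)) }.

Definition rdim (K : fieldType) (Q : quiver) (V : rep K Q) : nat :=
  (\sum_x \dim {:rvect V x})%N.

Definition rep_iso (K : fieldType) (Q : quiver) (V W : rep K Q) : Prop :=
  exists phi : forall x, 'Hom(rvect V x, rvect W x),
    (forall x, bijective (phi x)) /\
    forall a, (phi (qhead a) \o rmap V a = rmap W a \o phi (qtail a))%VF.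

Section PairMap.
Variables (K : fieldType) (U U' W W' : vectType K).
Variables (f : 'Hom(U, U')) (g : 'Hom(W, W')).

Definition pair_map_fun (p : U * W) : U' * W' := (f p.1, g p.2).
Fact pair_map_linear : linear pair_map_fun.
Proof. by move=> k [u w] [u' w']; rewrite /pair_map_fun /= !linearP. Qed.
HB.instance Definition _ :=
  GRing.isLinear.Build K (U * W)%type (U' * W')%type _ pair_map_fun pair_map_linear.

Definition pair_map : 'Hom((U * W)%type, (U' * W')%type) := linfun pair_map_fun.
End PairMap.

Definition rep_sum (K : fieldType) (Q : quiver) (V W : rep K Q) : rep K Q :=
  @Rep K Q (fun x => (rvect V x * rvect W x)%type)
    (fun a => pair_map (rmap V a) (rmap W a)).

Definition indecomposable (K : fieldType) (Q : quiver) (V : rep K Q) : Prop :=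
  rdim V <> 0%N /\
  forall A B : rep K Q, rep_iso V (rep_sum A B) -> rdim A = 0%N \/ rdim B = 0%N.

Section Pushforward.
Variables (K : fieldType) (Q' Q : quiver) (f : quiver_hom Q' Q) (V : rep K Q').

Definition fiber (x : vert Q) : finType := {y : vert Q' | hom_vert f y == x}.
Definition arr_fiber (a : arr Q) : finType := {b : arr Q' | hom_arr f b == a}.

Fact fiber_tail_subproof a (b : arr_fiber a) : hom_vert f (qtail (val b)) == qtail a.
Proof. by rewrite hom_tail (eqP (valP b)). Qed.
Fact fiber_head_subproof a (b : arr_fiber a) : hom_vert f (qhead (val b)) == qhead a.
Proof. by rewrite hom_head (eqP (valP b)). Qed.

Definition fiber_tail a (b : arr_fiber a) : fiber (qtail a) :=
  exist _ (qtail (val b)) (fiber_tail_subproof b).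
Definition fiber_head a (b : arr_fiber a) : fiber (qhead a) :=
  exist _ (qhead (val b)) (fiber_head_subproof b).

Definition push_vect (x : vert Q) : vectType K :=
  dsum (fun y : fiber x => rvect V (val y)).

(* Composing with [dsum_proj] extends the map at [b] by zero on the summands
   other than the one at the tail of [b]. *)
Definition push_map (a : arr Q) : 'Hom(push_vect (qtail a), push_vect (qhead a)) :=
  \sum_(b : arr_fiber a)
    (dsum_inj (fun y : fiber (qhead a) => rvect V (val y)) (fiber_head b)
       \o rmap V (val b)
       \o dsum_proj (fun y : fiber (qtail a) => rvect V (val y)) (fiber_tail b))%VF.

Definition pushforward : rep K Q := Rep push_map.

End Pushforward.

Definition id_rep (K : fieldType) (Q : quiver) : rep K Q :=
  @Rep K Q (fun=> K^o) (fun=> \1%VF).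

Definition tree_module (K : fieldType) (Q : quiver) (M : rep K Q) : Prop :=
  indecomposable M /\
  exists (T : quiver) (f : quiver_hom T Q),
    tree_quiver T /\ rep_iso M (pushforward f (id_rep K T)).

(* [TM_count K g d n] states that TM_{S_g}(d) = n over [K]. *)
Definition TM_count (K : fieldType) (g d n : nat) : Prop :=
  iso_class_count
    (fun M : rep K (loop_quiver g) => tree_module M /\ rdim M = d)
    (@rep_iso K (loop_quiver g)) n.

(* L (x)_F V, written in coordinates with respect to the F-bases [vbasis]. *)
Definition scalar_ext (F L : fieldType) (iota : {rmorphism F -> L}) (Q : quiver)
    (V : rep F Q) : rep L Q :=
  @Rep L Q (fun x => 'rV[L]_(\dim {:rvect V x}))
    (fun a => linfun (mulmxr (map_mx iota
       (passmx.mxof (vbasis {:rvect V (qtail a)}) (vbasis {:rvect V (qhead a)})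
          (rmap V a))))).

Definition absolutely_indecomposable (F : fieldType) (Q : quiver) (V : rep F Q) :
    Prop :=
  exists (L : closedFieldType) (iota : {rmorphism F -> L}),
    integralRange iota /\ indecomposable (scalar_ext iota V).

(* [A] is Kac's polynomial A_{S_g}(d, q) in the indeterminate q: it has the
   right value at #|F| for all finite fields F, with the exception of those
   whose characteristic is in some finite list. *)
Definition is_Kac_polynomial (g d : nat) (A : {poly int}) : Prop :=
  exists excluded : seq nat, forall F : finFieldType,
    (forall p, p \in [pchar F] -> p \notin excluded) ->
    exists2 n : nat,
      iso_class_count
        (fun V : rep F (loop_quiver g) =>
           absolutely_indecomposable V /\ rdim V = d)
        (@rep_iso F (loop_quiver g)) n
      & A.[#|F|%:R] = n%:R.

(* The known theorem of Helleloid and Rodriguez-Villegas in dimension [d]. *)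
Definition Helleloid_Rodriguez_Villegas (d : nat) : Prop :=
  forall A : nat -> {poly int}, (forall g, is_Kac_polynomial g d (A g)) ->
  exists B : {poly rat},
    [/\ forall g : nat, B.[g%:R] = (A g).[1]%:~R,
        size B = d &
        lead_coef B = (2 ^ d.-1 * #|labeled_trees d|)%:R / d`!%:R].

(* The polynomial binom('X, i). *)
Definition binomial_poly (i : nat) : {poly rat} :=
  i`!%:R^-1 *: \prod_(j < i) ('X - j%:R%:P).

Lemma binomial_polyE (i g : nat) : (binomial_poly i).[g%:R] = 'C(g, i)%:R.
Proof.
have fact_neq0 : i`!%:R != 0 :> rat by rewrite pnatr_eq0 -lt0n fact_gt0.
apply: (mulfI fact_neq0).
rewrite hornerZ mulVKf // horner_prod mulrC -natrM bin_ffact ffact_prod.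
under eq_bigr => j _ do rewrite hornerXsubC.
have [le_ig | lt_gi] := leqP i g.
  rewrite natr_prod; apply: eq_bigr => j _.
  by rewrite natrB // (leq_trans (ltnW (ltn_ord j)) le_ig).
rewrite (bigD1 (Ordinal lt_gi)) //= subrr mul0r.
by rewrite (bigD1 (Ordinal lt_gi)) //= subnn mul0n.
Qed.

(* Main.v *)
Require Import Defs.
From HB Require Import structures.
From mathcomp Require Import all_boot all_order all_fingroup all_algebra.
From mathcomp Require Import boolp.

(** The dimension of the module pushed forward from a tree quiver is its number
    of vertices, and a tree with [d] vertices has [d - 1] arrows
    ([tree_card_arr]); hence at most [d - 1] loops act by a nonzero map on a tree
    module of dimension [d]. Restriction to these loops and extension by zero
    commute with direct sums, so they are inverse bijections between the classes
    of tree modules with support a given set of [i] loops and the classes of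
    sincere tree modules of [S_i], those on which every loop acts by a nonzero
    map ([TM_count_support]). With [c_i] the number of the latter,
    [TM_{S_g}(d)] is the sum over the subsets of the set of loops, that is
    [\sum_(i < d) c_i 'C(g, i)], and only [c_(d-1)] remains to be computed.

    In a sincere tree module of [S_(d-1)] the [d - 1] arrows of the tree are
    mapped bijectively onto the loops, so each loop acts by one matrix unit.
    Connectedness forces an idempotent endomorphism of such a module to be [0] or
    [1], so it is always indecomposable ([tree_mx_indec]). The products, kernels
    and images of the matrix units tell which arrows share which ends, so the
    module determines the tree with its arrows labeled by the loops
    ([tree_mx_iso]). Thus [c_(d-1)] is the number of arrow-labeled tree quivers
    with [d] vertices up to isomorphism.

    That number is computed from the finite set of tree quivers on [d] numbered
    vertices with [d - 1] numbered arrows ([tree_arrows]). Listing and orienting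
    the edges of labeled trees, this set has [2^(d-1) (d-1)! #T_d] elements
    ([card_tree_arrows]). The renumberings of the vertices act freely on it, with
    [c_(d-1)] orbits, whence [c_(d-1) d! = 2^(d-1) (d-1)! #T_d]
    ([card_tree_arrows_free]). The orbits of all renumberings are the isomorphism
    classes of tree quivers, with stabilizers the groups [Aut(Q)], whence
    [c_(d-1) d!] is also the sum of [d! (d-1)! / #Aut(Q)]
    ([card_tree_arrows_Aut]).

    The leading term of [A_{S_g}(d, 1)] is read off the theorem of Helleloid and
    Rodriguez-Villegas, the coefficient of ['X^(d-1)] being that of the binomial
    polynomial divided by [(d-1)!]. *)

Set Implicit Arguments.
Unset Strict Implicit.
Unset Printing Implicit Defensive.

Import GRing.Theory Num.Theory.
Local Open Scope ring_scope.

(** * Counting isomorphism classes *)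

Section Counting.
Variables (T : Type) (P : T -> Prop) (iso : T -> T -> Prop).

Lemma iso_representatives_fin (I : finType) (s : I -> T) :
    (forall i, P (s i)) -> (forall i j, iso (s i) (s j) -> i = j) ->
    (forall V, P V -> exists i, iso V (s i)) ->
  iso_representatives P iso (fun i : 'I_#|I| => s (enum_val i)).
Proof.
move=> sP sI sS; split=> [i | i j /sI/enum_val_inj // | V /sS[i iVs]] //.
by exists (enum_rank i); rewrite enum_rankK.
Qed.

Lemma iso_class_count_fin (I : finType) (s : I -> T) :
    (forall i, P (s i)) -> (forall i j, iso (s i) (s j) -> i = j) ->
    (forall V, P V -> exists i, iso V (s i)) ->
  iso_class_count P iso #|I|.
Proof. by move=> sP sI sS; eexists; apply: iso_representatives_fin sS. Qed.

Hypothesis iso_sym : forall V W, iso V W -> iso W V.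
Hypothesis iso_trans : forall U V W, iso U V -> iso V W -> iso U W.

Lemma iso_class_count_le n m :
  iso_class_count P iso n -> iso_class_count P iso m -> (n <= m)%N.
Proof.
move=> [s [sP sI _]] [s' [_ _ s'S]].
have [f fP] : {f : 'I_n -> 'I_m & forall i, iso (s i) (s' (f i))}.
  by apply: (@choice _ _ (fun i j => iso (s i) (s' j))) => i; apply: s'S.
have f_inj : injective f.
  move=> i j fij; apply: sI; apply: iso_trans (fP i) _.
  by rewrite fij; apply: iso_sym.
by have := leq_card f f_inj; rewrite !card_ord.
Qed.

Lemma iso_class_count_uniq n m :
  iso_class_count P iso n -> iso_class_count P iso m -> n = m.
Proof.
by move=> cn cm; apply/eqP; rewrite eqn_leq !(iso_class_count_le cn, iso_class_count_le cm).
Qed.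

(** Finitely many candidates leave finitely many classes: each class of
    candidates is represented by the candidate that [pick] selects in it. *)
Lemma iso_class_count_exists (C : finType) (r : C -> T) :
    (forall V W, iso V W -> P V -> P W) ->
    (forall V, P V -> exists c, iso V (r c)) ->
  exists n, iso_class_count P iso n.
Proof.
move=> P_iso rS.
pose e c c' := `[< P (r c') /\ iso (r c) (r c') >].
pose can c := odflt c [pick c' | e c c'].
have e_can c : P (r c) -> e c (can c).
  move=> Pc; rewrite /can; case: pickP => [c' //|/(_ c)].
  have cc : iso (r c) (r c).
    by have [c' icc'] := rS _ Pc; apply: iso_trans (icc') (iso_sym icc').
  by move/asboolP; case.
have can_eq c c' : P (r c) -> iso (r c) (r c') -> can c = can c'.
  move=> Pc icc'; have /asboolP[_ _] := e_can _ Pc.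
  have ee : e c =1 e c'.
    move=> x; apply/asboolP/asboolP => -[Px ix]; split=> //.
      exact: iso_trans (iso_sym icc') ix.
    exact: iso_trans icc' ix.
  have := e_can _ Pc; rewrite /can (eq_pick ee); case: pickP => // none.
  by rewrite /= ee none.
pose I := {c : C | `[< P (r c) >] && (can c == c)}.
exists #|{: I}|; apply: (iso_class_count_fin (s := fun i : I => r (val i))).
- by case=> c /= /andP[/asboolP].
- move=> [c pc] [c' pc'] /= icc'; apply/val_inj => /=.
  have /andP[/asboolP Pc /eqP <-] := pc; have /andP[_ /eqP <-] := pc'.
  exact: can_eq.
- move=> V PV; have [c iVc] := rS _ PV; have Pc := P_iso _ _ iVc PV.
  have /asboolP[Pcan ican] := e_can _ Pc.
  have canP : `[< P (r (can c)) >] && (can (can c) == can c).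
    by rewrite -(can_eq _ _ Pc ican) eqxx andbT; apply/asboolP.
  by exists (exist _ (can c) canP) => /=; apply: iso_trans ican.
Qed.

End Counting.

(** * Trees *)

Lemma eq_set2 (T : finType) (a b x y : T) :
  ([set a; b] == [set x; y]) = ((a == x) && (b == y)) || ((a == y) && (b == x)).
Proof.
apply/eqP/orP => [E | [] /andP[/eqP-> /eqP->] //]; last by rewrite setUC.
have := set21 a b; have := set22 a b; have := set21 x y; have := set22 x y.
rewrite -{1 2}E {3 4}E !inE => /orP[]/eqP E1 /orP[]/eqP E2 /orP[]/eqP E3 /orP[]/eqP E4;
  subst; rewrite ?eqxx; auto.
Qed.

Section TreeRel.
Variable V : finType.

Lemma eq_is_tree (e e' : rel V) : e =2 e' -> is_tree e = is_tree e'.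
Proof.
move=> ee'; congr [&& _, _ & _].
  by apply: eq_forallb => x; apply: eq_forallb => y; rewrite (eq_connect ee').
apply: eq_forallb => n; apply: eq_forallb => p.
by rewrite /ucycleb (eq_cycle ee').
Qed.

(** In a forest a path that avoids an edge cannot join its two ends: closed up
    by that edge it would be a cycle. *)
Lemma acyclic_bridge (e : rel V) x y : acyclic e -> e y x -> x != y ->
  ~~ connect (fun u v => e u v && ([set u; v] != [set x; y])) x y.
Proof.
move=> /acyclicP eA eyx xy; apply/connectP => -[p /shortenP[q qp uq _] lq].
have : (size (x :: q) <= 2)%N.
  apply: eA; rewrite /ucycle uq andbT /= rcons_path -lq eyx andbT.
  by apply: sub_path qp => u v /andP[].
case: q qp uq lq => [|z [|]] //= => [_ _ E|].
  by rewrite E eqxx in xy.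
by rewrite andbT => /andP[_] H _ E; rewrite -E eqxx in H.
Qed.

End TreeRel.

Lemma is_tree_map (V W : finType) (f : V -> W) (e : rel V) (e' : rel W) :
  bijective f -> (forall x y, e' (f x) (f y) = e x y) -> is_tree e -> is_tree e'.
Proof.
move=> f_bij fe /and3P[V0 eC eA]; have f_inj := bij_inj f_bij.
apply/and3P; split; first by rewrite -(bij_eq_card f_bij).
  have [g _ fK] := f_bij; apply/forallP => x; apply/forallP => y.
  rewrite -(fK x) -(fK y).
  have /forallP/(_ (g x))/forallP/(_ (g y))/connectP[p ep ->] := eC.
  apply/connectP; exists (map f p); last by rewrite last_map.
  by rewrite path_map (eq_path (e' := e)).
have [g fgK gfK] := f_bij; apply/acyclicP => p /andP[cp up].
rewrite -(size_map g); apply: (acyclicP _ eA).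
rewrite /ucycle map_inj_uniq ?up ?andbT; last exact: can_inj gfK.
by rewrite cycle_map (eq_cycle (e' := e')) // => x y /=; rewrite -fe !gfK.
Qed.

Section TreeQuiver.

Lemma adjacentE (Q : quiver) (x y : vert Q) :
  adjacent x y = [exists a : arr Q, [set qtail a; qhead a] == [set x; y]].
Proof. by apply: eq_existsb => a; rewrite eq_set2. Qed.

Lemma adjacent_arr (Q : quiver) (a : arr Q) : adjacent (qtail a) (qhead a).
Proof. by apply/existsP; exists a; rewrite !eqxx. Qed.

Lemma adjacentC (Q : quiver) : symmetric (@adjacent Q).
Proof. by move=> x y; rewrite !adjacentE setUC. Qed.

Definition tree_quiverb (Q : quiver) : bool :=
  [&& [forall a : arr Q, qtail a != qhead a],
      [forall a : arr Q, forall b : arr Q,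
        ([set qtail a; qhead a] == [set qtail b; qhead b]) ==> (a == b)] &
      is_tree (@adjacent Q)].

Lemma tree_quiverP (Q : quiver) : reflect (tree_quiver Q) (tree_quiverb Q).
Proof.
apply: (iffP and3P) => -[]; last first.
  move=> H1 H2 H3; split=> //; first exact/forallP.
  apply/forallP => a; apply/forallP => b; apply/implyP => /eqP/H2 ->.
  exact: eqxx.
move=> /forallP H1 /forallP H2 H3; split=> // a b /eqP E.
by have /forallP/(_ b) := H2 a; rewrite E => /eqP.
Qed.

Lemma tree_quiver_iso (Q Q' : quiver) :
  quiver_iso Q Q' -> tree_quiver Q -> tree_quiver Q'.
Proof.
move=> [f [fv_bij fa_bij]] [loopless simple tree].
have fv_inj := bij_inj fv_bij; have [ga gaK faK] := fa_bij.
have setE (a : arr Q) : [set qtail (hom_arr f a); qhead (hom_arr f a)] =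
    [set hom_vert f x | x in [set qtail a; qhead a]].
  by rewrite imsetU !imset_set1 hom_tail hom_head.
split=> [a | a b | ].
- by rewrite -(faK a) -hom_tail -hom_head (inj_eq fv_inj).
- rewrite -(faK a) -(faK b) !setE => /(imset_inj fv_inj)/simple.
  by move=> ->.
apply: is_tree_map fv_bij _ tree => x y; rewrite !adjacentE.
have xyE : [set hom_vert f x; hom_vert f y] = [set hom_vert f z | z in [set x; y]].
  by rewrite imsetU !imset_set1.
apply/existsP/existsP => -[a].
  rewrite -(faK a) setE xyE => /eqP/(imset_inj fv_inj) E.
  by exists (ga a); rewrite E.
by move=> /eqP E; exists (hom_arr f a); rewrite setE E xyE.
Qed.

Variable Q : quiver.
Hypothesis Q_tree : tree_quiver Q.

(** The coboundary [f |-> (f (head a) - f (tail a))_a] from functions on the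
    vertices to functions on the arrows: connectedness makes its kernel the line
    of constants, and since the arrow [a] is a bridge, the indicator of one of
    the two sides of [a] is mapped to plus or minus the indicator of [a], whence
    surjectivity. Comparing ranks gives the number of arrows. *)
Lemma tree_card_arr : #|vert Q| = #|arr Q|.+1.
Proof.
have [loopless simple /and3P[V0 QC QA]] := Q_tree.
pose tl (k : 'I_#|arr Q|) := qtail (enum_val k).
  pose hd (k : 'I_#|arr Q|) := qhead (enum_val k).
pose D : 'M[rat]_(#|vert Q|, #|arr Q|) :=
  \matrix_(i, k) ((enum_val i == hd k)%:R - (enum_val i == tl k)%:R).
have DE m (f : 'M[rat]_(m, _)) i k :
    (f *m D) i k = f i (enum_rank (hd k)) - f i (enum_rank (tl k)).
  rewrite !mxE; under eq_bigr do rewrite mxE mulrBr.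
  rewrite sumrB; congr (_ - _).
    rewrite (bigD1 (enum_rank (hd k))) //= enum_rankK eqxx mulr1 big1 ?addr0 //.
    move=> j jk; case: eqP => [E|]; last by rewrite mulr0.
    by rewrite -E enum_valK eqxx in jk.
  rewrite (bigD1 (enum_rank (tl k))) //= enum_rankK eqxx mulr1 big1 ?addr0 //.
  move=> j jk; case: eqP => [E|]; last by rewrite mulr0.
  by rewrite -E enum_valK eqxx in jk.
have kerD : \rank (kermx D) = 1%N.
  apply/eqP; rewrite eqn_leq; apply/andP; split; last first.
    rewrite lt0n mxrank_eq0; apply/eqP => ker0.
    have : ((const_mx 1 : 'rV[rat]_#|vert Q|) <= kermx D)%MS.
      by apply/sub_kermxP; apply/rowP => k; rewrite DE !mxE subrr.
    rewrite ker0 submx0 => /eqP/rowP/(_ (Ordinal V0)); rewrite !mxE.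
    by move/eqP; rewrite oner_eq0.
  suff /mxrankS : (kermx D <= (const_mx 1 : 'rV[rat]_#|vert Q|))%MS.
    by move/leq_trans; apply; apply: rank_leq_row.
  apply/row_subP => i; set u := row i _.
  have uD : u *m D = 0 by apply/sub_kermxP; apply: row_sub.
  clearbody u; have uconst x y : u 0 (enum_rank x) = u 0 (enum_rank y).
    have /forallP/(_ x)/forallP/(_ y) := QC.
    move=> /connectP[p]; elim: p x => [|z p IHp] x /=; first by move=> _ ->.
    move=> /andP[exz /IHp/[apply] <-].
    case/existsP: exz => a; move/rowP/(_ (enum_rank a)): uD.
    rewrite DE mxE /hd /tl !enum_rankK => /eqP; rewrite subr_eq0 => /eqP E.
    by case/orP => /andP[/eqP <- /eqP <-].
  apply/sub_rVP; exists (u 0 (Ordinal V0)).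
  apply/rowP => j; rewrite !mxE mulr1 -(enum_valK j) -[Ordinal V0]enum_valK.
  exact: uconst.
pose cut k (u v : vert Q) := adjacent u v && ([set u; v] != [set tl k; hd k]).
pose C : 'M[rat]_(#|arr Q|, #|vert Q|) :=
  \matrix_(k, i) - (connect (cut k) (tl k) (enum_val i))%:R.
have CD : C *m D = 1%:M.
  apply/matrixP => k k'; rewrite DE !mxE !enum_rankK.
  have [<-|kk'] := eqVneq k k'.
    rewrite connect0 (negbTE (acyclic_bridge QA _ _)) ?oppr0 ?sub0r ?opprK //.
      by rewrite adjacentC adjacent_arr.
    exact: loopless.
  have cutk' : cut k (tl k') (hd k').
    rewrite /cut adjacent_arr; apply: contraNneq kk' => /simple/enum_val_inj.
    by move=> ->.
  have cutC : symmetric (cut k).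
    by move=> u v; rewrite /cut adjacentC setUC.
  rewrite (same_connect_r (sym_connect_sym cutC) (connect1 cutk')).
  by rewrite subrr.
have rD : \rank D = #|arr Q|.
  apply/eqP; rewrite eqn_leq rank_leq_col /=.
  by have := mxrankM_maxr C D; rewrite CD mxrank1.
have := mxrank_ker D; rewrite kerD rD => E.
by rewrite -(subnKC (n := #|vert Q|) (m := #|arr Q|)) -?E ?addn1 // -rD rank_leq_row.
Qed.

(** Connectedness leaves an isolated vertex no room for another vertex. *)
Lemma tree_vertex_covered (x y : vert Q) :
  x != y -> exists a : arr Q, (x == qtail a) || (x == qhead a).
Proof.
have [_ _ /and3P[_ /forallP/(_ x)/forallP/(_ y)/connectP[[|z p] /=]]] := Q_tree.
  by move=> _ ->; rewrite eqxx.
move=> /andP[/existsP[a /orP[]/andP[/eqP Et /eqP Eh] _]] _ _; exists a.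
  by rewrite Et eqxx.
by rewrite Eh eqxx orbT.
Qed.

End TreeQuiver.

(** * Tree quivers on numbered vertices and arrows *)

Lemma quiver_iso_trans (Q1 Q2 Q3 : quiver) :
  quiver_iso Q1 Q2 -> quiver_iso Q2 Q3 -> quiver_iso Q1 Q3.
Proof.
move=> [f [fv fa]] [g [gv ga]].
have ht b : (hom_vert g \o hom_vert f) (qtail b) = qtail ((hom_arr g \o hom_arr f) b).
  by rewrite /= !hom_tail.
have hh b : (hom_vert g \o hom_vert f) (qhead b) = qhead ((hom_arr g \o hom_arr f) b).
  by rewrite /= !hom_head.
by exists (QuiverHom ht hh); split; apply: bij_comp.
Qed.

Section ArrowList.
Variable n : nat.
Implicit Type F : {ffun 'I_n -> 'I_n.+1 * 'I_n.+1}.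

Definition arrows_quiver F : quiver :=
  @Quiver 'I_n.+1 'I_n (fun b => (F b).1) (fun b => (F b).2).

Definition tree_arrows := [set F | tree_quiverb (arrows_quiver F)].

Lemma tree_arrowsP F : reflect (tree_quiver (arrows_quiver F)) (F \in tree_arrows).
Proof. by rewrite inE; apply: tree_quiverP. Qed.

Lemma tree_quiver_arrows (Q : quiver) : tree_quiver Q -> #|vert Q| = n.+1 ->
  exists2 F, F \in tree_arrows & quiver_iso Q (arrows_quiver F).
Proof.
move=> Q_tree cV; have cA : #|arr Q| = n.
  by apply/succn_inj; rewrite -cV (tree_card_arr Q_tree).
pose rv (x : vert Q) := cast_ord cV (enum_rank x).
pose ra (b : arr Q) := cast_ord cA (enum_rank b).
pose ra' (i : 'I_n) : arr Q := enum_val (cast_ord (esym cA) i).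
have raK : cancel ra ra' by move=> b; rewrite /ra /ra' cast_ordK enum_rankK.
have ra'K : cancel ra' ra by move=> i; rewrite /ra /ra' enum_valK cast_ordKV.
pose F := [ffun i => (rv (qtail (ra' i)), rv (qhead (ra' i)))].
have QF : quiver_iso Q (arrows_quiver F).
  have ft b : rv (qtail b) = @qtail (arrows_quiver F) (ra b).
    by rewrite /= ffunE raK.
  have fh b : rv (qhead b) = @qhead (arrows_quiver F) (ra b).
    by rewrite /= ffunE raK.
  exists (@QuiverHom Q (arrows_quiver F) rv ra ft fh); split; last by exists ra'.
  exists (fun i => enum_val (cast_ord (esym cV) i)) => x.
    by rewrite /= cast_ordK enum_rankK.
  by rewrite /= /rv enum_valK cast_ordKV.
by exists F => //; apply/tree_arrowsP; apply: tree_quiver_iso QF Q_tree.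
Qed.

(** ** Renumbering vertices and arrows *)

Definition relabel F (p : 'S_n.+1 * 'S_n) : {ffun 'I_n -> 'I_n.+1 * 'I_n.+1} :=
  [ffun b => (p.1 (F ((p.2)^-1%g b)).1, p.1 (F ((p.2)^-1%g b)).2)].

Fact relabel1 : relabel^~ 1%g =1 id.
Proof.
move=> F; apply/ffunP => b; rewrite ffunE invg1 !perm1.
by case: (F b).
Qed.

Fact relabelM F : act_morph relabel F.
Proof.
by move=> p q; apply/ffunP => b; rewrite !ffunE /= invMg !permM.
Qed.

Canonical relabel_action := TotalAction relabel1 relabelM.

Lemma relabel_quiver_iso F p : quiver_iso (arrows_quiver F) (arrows_quiver (relabel F p)).
Proof.
have ft (b : 'I_n) : p.1 (F b).1 = (relabel F p (p.2 b)).1.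
  by rewrite ffunE permK.
have fh (b : 'I_n) : p.1 (F b).2 = (relabel F p (p.2 b)).2.
  by rewrite ffunE permK.
exists (@QuiverHom (arrows_quiver F) (arrows_quiver _) p.1 p.2 ft fh).
by split; [exists (p.1^-1)%g; [apply: permK | apply: permKV]
          | exists (p.2^-1)%g; [apply: permK | apply: permKV]].
Qed.

Lemma relabel_tree F p : (relabel F p \in tree_arrows) = (F \in tree_arrows).
Proof.
apply/tree_arrowsP/tree_arrowsP; last first.
  by apply: tree_quiver_iso; apply: relabel_quiver_iso.
rewrite -{2}[F](actK relabel_action p).
by apply: tree_quiver_iso; apply: relabel_quiver_iso.
Qed.

Lemma relabel_acts (G : {group 'S_n.+1 * 'S_n}) : [acts G, on tree_arrows | relabel_action].
Proof.
by apply/actsP => p _ F; apply: relabel_tree.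
Qed.

Lemma relabel_quiver_isoP F F' : quiver_iso (arrows_quiver F) (arrows_quiver F') ->
  F' \in orbit relabel_action setT F.
Proof.
move=> [f [/bij_inj fv /bij_inj fa]].
pose p : 'S_n.+1 * 'S_n := (perm fv, perm fa).
apply/orbitP; exists p => //; apply/ffunP => b.
rewrite ffunE -{3}[b](permKV p.2); move: (_ b) => c.
rewrite [RHS]surjective_pairing /= !permE.
by congr (_, _); [apply: (hom_tail f c) | apply: (hom_head f c)].
Qed.

Lemma relabel_stab F : 'C[F | relabel_action]%g = quiver_Aut (arrows_quiver F).
Proof.
apply/setP => p; rewrite [RHS]inE; apply/idP/idP => [/astab1P pF | /forallP pF].
  apply/forallP => b.
  move/ffunP/(_ (p.2 b)): pF; rewrite ffunE permK /= => <-; by rewrite /= !eqxx.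
apply/astab1P/ffunP => b; have /andP[/eqP Et /eqP Eh] := pF (p.2^-1 b)%g.
move: Et Eh; rewrite /= permKV ffunE => <- <-.
by rewrite -surjective_pairing.
Qed.


Definition orbit_repr (A : {set {ffun 'I_n -> 'I_n.+1 * 'I_n.+1}}) :=
  odflt [ffun=> (ord0, ord0)] [pick F in A].

Lemma orbit_reprP (G : {group 'S_n.+1 * 'S_n}) A :
    A \in orbit relabel_action G @: tree_arrows ->
  orbit_repr A \in tree_arrows /\ A = orbit relabel_action G (orbit_repr A).
Proof.
case/imsetP=> F F_tree ->; rewrite /orbit_repr; case: pickP => [F' F'F | /(_ F)].
  split; last by apply/esym/orbit_eqP.
  by have /orbitP[p _ <-] := F'F; rewrite relabel_tree.
by rewrite orbit_refl.
Qed.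

Lemma orbit_repr_mem (G : {group 'S_n.+1 * 'S_n}) F :
  orbit_repr (orbit relabel_action G F) \in orbit relabel_action G F.
Proof.
by rewrite /orbit_repr; case: pickP => [F' //|/(_ F)]; rewrite orbit_refl.
Qed.

(** The orbit-stabilizer formula for all renumberings: the stabilizer of a quiver
    is its group of automorphisms. *)
Lemma card_tree_arrows_Aut :
  \sum_(A in orbit relabel_action setT @: tree_arrows)
     ((n.+1)`! * n`!)%:R / #|quiver_Aut (arrows_quiver (orbit_repr A))|%:R
  = #|tree_arrows|%:R :> rat.
Proof.
rewrite -(acts_sum_card_orbit (relabel_acts setT)) natr_sum.
apply: eq_bigr => A /orbit_reprP[_ A_orb].
rewrite [in RHS]A_orb; move: (orbit_repr A) => {A A_orb} F.
have cAut : (0 < #|quiver_Aut (arrows_quiver F)|)%N.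
  by rewrite -relabel_stab cardG_gt0.
have <- : (#|orbit relabel_action setT F| * #|quiver_Aut (arrows_quiver F)|)%N
    = ((n.+1)`! * n`!)%N.
  rewrite -relabel_stab -(setTI 'C[_ | _]%g) card_orbit_stab cardsT card_prod.
  by rewrite !card_Sn.
by rewrite natrM mulfK // pnatr_eq0 -lt0n.
Qed.

Definition vertex_perms := setX_group [set: 'S_n.+1] (one_group 'S_n).

Lemma vertex_permsP F F' :
  reflect (exists s : 'S_n.+1, F' = [ffun b => (s (F b).1, s (F b).2)])
          (F' \in orbit relabel_action vertex_perms F).
Proof.
apply: (iffP orbitP) => [[[s u]] | [s ->]].
  rewrite !inE /= => /eqP -> <-; exists s.
  by apply/ffunP => b; rewrite !ffunE /= invg1 perm1.
exists (s, 1%g); first by rewrite !inE /=.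
by apply/ffunP => b; rewrite !ffunE /= invg1 perm1.
Qed.

(** The renumberings of the vertices act freely: one that fixes a tree quiver
    fixes the ends of all its arrows, hence all vertices. *)
Lemma card_tree_arrows_free :
  #|tree_arrows| =
  (#|orbit relabel_action vertex_perms @: tree_arrows| * (n.+1)`!)%N.
Proof.
apply: card_uniform_partition (orbit_partition (relabel_acts _)).
move=> _ /imsetP[F /tree_arrowsP F_tree ->].
have c_perms : #|vertex_perms| = (n.+1)`!.
  by rewrite cardsX cards1 muln1 cardsT card_Sn.
have := card_orbit_stab relabel_action vertex_perms F.
suff -> : ('C_vertex_perms[F | relabel_action] = 1)%g.
  by rewrite cards1 muln1 c_perms.
apply/trivgP/subsetP => -[s u] /setIP[/setXP[_ /set1P -> {u}] /astab1P sF].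
have fix_ends b : s (F b).1 = (F b).1 /\ s (F b).2 = (F b).2.
  by move/ffunP/(_ b): sF; rewrite ffunE /= invg1 perm1 ; case: (F b) => x y [-> ->].
apply/set1P; congr (_, _); apply/permP => x; rewrite perm1; apply/eqP.
have [y xy|all_x] := pickP [pred y | x != y]; last first.
  by have := all_x (s x); rewrite /= eq_sym => /negbFE.
have [b /orP[]/eqP xE] := tree_vertex_covered F_tree xy; rewrite xE.
  by have [-> _] := fix_ends b.
by have [_ ->] := fix_ends b.
Qed.

End ArrowList.

(** ** Counting by labeled trees *)

Section LabeledTrees.
Variable n : nat.
Implicit Types (E : {set {set 'I_n.+1}}) (G : {ffun 'I_n -> {set 'I_n.+1}}).

(** Orienting the edges in an arbitrary way gives a tree quiver, whose arrows are
    already counted. *)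
Lemma labeled_tree_card E : E \in labeled_trees n.+1 -> #|E| = n.
Proof.
rewrite inE => /andP[/forall_inP E2 E_tree].
pose A := {e : {set 'I_n.+1} | e \in E}.
have [th thP] : exists th : A -> 'I_n.+1 * 'I_n.+1,
    forall e, (th e).1 != (th e).2 /\ val e = [set (th e).1; (th e).2].
  pose Pth (e : A) (th : 'I_n.+1 * 'I_n.+1) := th.1 != th.2 /\ val e = [set th.1; th.2].
  apply: (fin_all_exists (P := Pth)) => -[e eE].
  by have /cards2P[x [y xy]] := E2 e eE; exists (x, y).
pose Q := @Quiver 'I_n.+1 A (fun e => (th e).1) (fun e => (th e).2).
have Q_tree : tree_quiver Q.
  split=> [e|e e'|]; first by have [] := thP e.
    rewrite /=; have [_ <-] := thP e; have [_ <-] := thP e'.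
    exact: val_inj.
  rewrite (eq_is_tree (e' := fun x y => [set x; y] \in E)) // => x y.
  rewrite adjacentE.
  apply/existsP/idP => [[e /eqP <-]|xyE].
    by have [_ <-] := thP e; apply: valP.
  pose e : A := exist (fun e => e \in E) _ xyE.
  by exists e => /=; have [_ <-] := thP e.
have [cA] : n.+1 = #|{: A}|.+1 by rewrite -[LHS]card_ord; apply: tree_card_arr Q_tree.
by rewrite [RHS]cA card_sig; apply: eq_card => e; rewrite inE.
Qed.

Definition edge_list (F : {ffun 'I_n -> 'I_n.+1 * 'I_n.+1}) :=
  [ffun b => [set (F b).1; (F b).2]].

Definition tree_edge_lists :=
  [set G : {ffun 'I_n -> {set 'I_n.+1}} |
    injectiveb G & [set G b | b : 'I_n] \in labeled_trees n.+1].

Lemma edge_list_tree F : (F \in tree_arrows n) = (edge_list F \in tree_edge_lists).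
Proof.
have adjE : @adjacent (arrows_quiver F) =2
    (fun x y => [set x; y] \in [set edge_list F b | b : 'I_n]).
  move=> x y; rewrite adjacentE; apply/existsP/imsetP => -[b].
    by move/eqP => E; exists b => //; rewrite ffunE -E.
  by move=> _ ->; exists b; rewrite ffunE /=.
apply/tree_arrowsP/idP => [[loopless simple Q_tree] | ].
  rewrite !inE -(eq_is_tree adjE) Q_tree andbT; apply/andP; split.
    by apply/injectiveP => a b; rewrite !ffunE; apply: simple.
  apply/forall_inP => _ /imsetP[b _ ->]; rewrite ffunE cards2.
  by have := loopless b; rewrite /= => ->.
rewrite !inE -(eq_is_tree adjE) => /and3P[/injectiveP F_inj /forall_inP F2 Q_tree].
split=> // [b | a b E]; last by apply: F_inj; rewrite !ffunE.
have := F2 _ (imset_f (edge_list F) (isT : b \in 'I_n)).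
by rewrite ffunE cards2 /=; case: (_ != _).
Qed.

Lemma card_orientations G : (forall b, #|G b| = 2) ->
  #|[set F | edge_list F == G]| = (2 ^ n)%N.
Proof.
move=> G2; pose D b := [pred p : 'I_n.+1 * 'I_n.+1 | [set p.1; p.2] == G b].
have fiberE F : (edge_list F == G) = (F \in family D).
  apply/eqP/familyP => [GE b|FD]; first by rewrite inE /= -GE ffunE.
  by apply/ffunP => b; rewrite ffunE; apply/eqP; have := FD b.
have -> : #|[set F | edge_list F == G]| = #|family D|.
  by apply: eq_card => F; rewrite inE fiberE.
rewrite card_family foldrE big_map big_enum /= -[in RHS](card_ord n) -prod_nat_const.
apply: eq_bigr => b _; have /eqP/cards2P[x [y [xy Gb]]] := G2 b.
rewrite -[RHS](_ : #|pred2 (x, y) (y, x)| = 2); last by rewrite card2 xpair_eqE (negbTE xy).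
by apply: eq_card => -[u v]; rewrite !inE /= Gb unfold_in /= eq_set2 !xpair_eqE.
Qed.

Lemma card_edge_lists E : #|E| = n ->
  #|[set G : {ffun 'I_n -> {set 'I_n.+1}} | injectiveb G & [set G b | b : 'I_n] == E]| = n`!.
Proof.
move=> cE; transitivity (#|E| ^_ #|'I_n|)%N; last by rewrite cE card_ord ffactnn.
rewrite -card_inj_ffuns_on.
apply: eq_card => G; rewrite !inE andbC; case: injectiveP => [G_inj|]; rewrite ?andbF //.
rewrite !andbT; apply/eqP/ffun_onP => [<- b | GE]; first exact: imset_f.
apply/eqP; rewrite eqEcard cE card_imset // card_ord leqnn andbT.
by apply/subsetP => _ /imsetP[b _ ->].
Qed.

(** A labeled tree has [n] edges, which can be listed in [n!] orders, and each
    edge of the list can be oriented in two ways. *)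
Lemma card_tree_arrows :
  #|tree_arrows n| = (2 ^ n * n`! * #|labeled_trees n.+1|)%N.
Proof.
transitivity (\sum_(G in tree_edge_lists) 2 ^ n)%N.
  rewrite -sum1_card (partition_big edge_list [in tree_edge_lists]) => [|F].
    apply: eq_bigr => G G_tree.
    have := G_tree; rewrite !inE => /and3P[_ /forall_inP G2 _].
    rewrite -(@card_orientations G) => [|b]; last by apply/eqP/G2/imset_f.
    rewrite -sum1dep_card; apply: eq_bigl => F; rewrite edge_list_tree.
    by apply: andb_idl => /eqP ->.
  by rewrite edge_list_tree.
rewrite sum_nat_const mulnC -mulnA; congr (_ * _)%N.
rewrite mulnC -sum_nat_const -sum1_card.
rewrite (partition_big (fun G => [set G b | b : 'I_n]) [in labeled_trees n.+1]) => [|G].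
  apply: eq_bigr => E E_tree; rewrite -(card_edge_lists (labeled_tree_card E_tree)).
  rewrite -sum1dep_card; apply: eq_bigl => G; rewrite inE -andbA; congr andb.
  by apply: andb_idl => /eqP ->.
by rewrite inE => /andP[].
Qed.

(** A star is a tree: since every edge contains the center, one of any two
    consecutive vertices of a cycle is the center, so the center would occur
    twice in a cycle with at least four vertices, and no triangle exists. *)
Lemma labeled_trees_gt0 : (0 < #|labeled_trees n.+1|)%N.
Proof.
apply/card_gt0P; exists [set [set ord0; i] | i in [set~ ord0 : 'I_n.+1]].
have eE (x y : 'I_n.+1) :
    ([set x; y] \in [set [set ord0; i] | i in [set~ ord0 : 'I_n.+1]])
    = (x == ord0) (+) (y == ord0).
  apply/imsetP/idP => [[i]|].
    rewrite !inE => i0 /eqP; rewrite eq_set2 => /orP[]/andP[/eqP-> /eqP->];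
    by rewrite eqxx (negbTE i0).
  case: (eqVneq x) => [->|x0] /=; first by exists y; rewrite ?inE.
  by move=> /eqP ->; exists x; rewrite ?inE // setUC.
rewrite inE; apply/andP; split.
  by apply/forall_inP => e /imsetP[i]; rewrite !inE => i0 ->; rewrite cards2 (eq_sym ord0) i0.
apply/and3P; split; first by rewrite card_ord.
  have c0 (x : 'I_n.+1) : connect (fun x y : 'I_n.+1 =>
       [set x; y] \in [set [set ord0; i] | i in [set~ ord0 : 'I_n.+1]]) ord0 x.
    have [->|x0] := eqVneq x ord0; first exact: connect0.
    by apply: connect1; rewrite eE eqxx (negbTE x0).
  have sym : symmetric (fun x y : 'I_n.+1 =>
       [set x; y] \in [set [set ord0; i] | i in [set~ ord0 : 'I_n.+1]]).
    by move=> x y; rewrite setUC.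
  apply/forallP => x; apply/forallP => y; apply: connect_trans (c0 y).
  by rewrite (sym_connect_sym sym).
apply/acyclicP => -[|x [|y [|z p]]] // /andP[].
rewrite /= !eE !inE !negb_or => /and3P[xy yz cp] /andP[/and3P[_ xz _]].
case/andP=> /andP[_ yp] _; move: xy yz cp.
case: (eqVneq x) => [x0|x0]; case: (eqVneq y) => // y0; case: (eqVneq z) => // z0 _ _.
  by rewrite x0 z0 eqxx in xz.
case: p yp => [_|w p] /=; rewrite !eE (negbTE z0) ?(negbTE x0) // inE negb_or.
by rewrite y0 eq_sym => /andP[/negbTE -> _].
Qed.

End LabeledTrees.

(** * Representations *)

Section RepIso.
Variables (K : fieldType) (Q : quiver).
Implicit Types V W : rep K Q.

Lemma rep_iso_refl V : rep_iso V V.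
Proof.
exists (fun=> \1%VF); split=> [x | a]; last by rewrite comp_lfun1l comp_lfun1r.
by exists \1%VF => u; rewrite !id_lfunE.
Qed.

Lemma bij_lfunK (aT rT : vectType K) (f : 'Hom(aT, rT)) :
  bijective f -> (f^-1 \o f = \1)%VF /\ (f \o f^-1 = \1)%VF.
Proof.
move=> f_bij; have kf : lker f == 0%VS by apply/lker0P/bij_inj.
have fK := lker0_lfunK kf; split; first exact: lker0_compVf.
apply/lfunP => u; rewrite comp_lfunE id_lfunE.
by have [g _ gK] := f_bij; rewrite -{1}(gK u) fK gK.
Qed.

Lemma rep_iso_sym V W : rep_iso V W -> rep_iso W V.
Proof.
move=> [phi [phi_bij phi_hom]].
have phiK x := (bij_lfunK (phi_bij x)).1.
have phiVK x := (bij_lfunK (phi_bij x)).2.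
exists (fun x => (phi x)^-1)%VF; split=> [x | a].
  exists (phi x) => u.
    by have /lfunP/(_ u) := phiVK x; rewrite comp_lfunE id_lfunE.
  by have /lfunP/(_ u) := phiK x; rewrite comp_lfunE id_lfunE.
rewrite -[LHS]comp_lfun1r -(phiVK (qtail a)) !comp_lfunA.
rewrite -[X in (X \o _)%VF]comp_lfunA -phi_hom.
by rewrite comp_lfunA phiK comp_lfun1l.
Qed.

Lemma rep_iso_trans U V W : rep_iso U V -> rep_iso V W -> rep_iso U W.
Proof.
move=> [phi [phi_bij phi_hom]] [psi [psi_bij psi_hom]].
exists (fun x => psi x \o phi x)%VF; split=> [x | a].
  apply: (@eq_bij _ _ (psi x \o phi x)); first exact: bij_comp.
  by move=> u; rewrite /= comp_lfunE.
by rewrite -comp_lfunA phi_hom !comp_lfunA psi_hom.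
Qed.

Lemma rep_iso_dim V W : rep_iso V W -> rdim V = rdim W.
Proof.
move=> [phi [phi_bij _]]; apply: eq_bigr => x _.
have kf : lker (phi x) == 0%VS by apply/lker0P/bij_inj.
have <- : (phi x @: fullv)%VS = fullv.
  apply/eqP; rewrite eqEsubv subvf /=; apply/subvP => u _.
  have [g _ gK] := phi_bij x; rewrite -(gK u); apply: memv_img; exact: memvf.
by rewrite limg_dim_eq // (eqP kf) capv0.
Qed.

Lemma rep_iso_indec V W : rep_iso V W -> indecomposable V -> indecomposable W.
Proof.
move=> VW [V0 V_indec]; split; first by rewrite -(rep_iso_dim VW).
by move=> A B WAB; apply: V_indec; apply: rep_iso_trans WAB.
Qed.

Lemma rep_iso_tree_module V W : rep_iso V W -> tree_module V -> tree_module W.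
Proof.
move=> VW [V_indec [T [f [T_tree Vf]]]]; split; first exact: rep_iso_indec VW _.
exists T, f; split=> //; exact: rep_iso_trans (rep_iso_sym VW) Vf.
Qed.

Lemma rep_iso_map_eq0 V W a : rep_iso V W -> rmap V a = 0 -> rmap W a = 0.
Proof.
move=> /rep_iso_sym[phi [phi_bij phi_hom]] Va0; apply/lfunP => u.
apply: (bij_inj (phi_bij (qhead a))); have /lfunP/(_ u) := phi_hom a.
by rewrite Va0 !comp_lfunE !lfunE linear0.
Qed.

End RepIso.

(** ** Matrix representations *)

Lemma rdim_loop (K : fieldType) (g : nat) (V : rep K (loop_quiver g)) :
  rdim V = \dim {:rvect V tt}.
Proof. by rewrite /rdim (bigD1 tt) //= big1 ?addn0 // => -[]. Qed.

Section MxRep.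
Variables (K : fieldType) (g d : nat).
Implicit Type X : 'I_g -> 'M[K]_d.

Definition mxrep X : rep K (loop_quiver g) :=
  @Rep K (loop_quiver g) (fun=> 'rV[K]_d) (fun a => linfun (mulmxr (X a))).

Lemma mxrepE X a (u : 'rV[K]_d) : rmap (mxrep X) a u = u *m X a.
Proof. by rewrite lfunE. Qed.

Lemma rdim_mxrep X : rdim (mxrep X) = d.
Proof. by rewrite rdim_loop dimvf /dim /= mul1n. Qed.

Lemma mxrep_eq0 X a : (rmap (mxrep X) a == 0) = (X a == 0).
Proof.
apply/eqP/eqP => [Xa0 | Xa0].
  apply/row_matrixP => i; rewrite row0 rowE.
  by have /lfunP/(_ (delta_mx 0 i)) := Xa0; rewrite mxrepE lfunE.
by apply/lfunP => u; rewrite mxrepE Xa0 mulmx0 lfunE.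
Qed.

Lemma mxrep_iso X Y : rep_iso (mxrep X) (mxrep Y) ->
  exists2 P : 'M[K]_d, P \in unitmx & forall a, X a *m P = P *m Y a.
Proof.
move=> [phi [phi_bij phi_hom]]; pose f : 'rV[K]_d -> 'rV[K]_d := phi tt.
exists (lin1_mx (phi tt)) => [|a].
  rewrite -row_free_unit -kermx_eq0; apply/rowV0P => u /sub_kermxP.
  rewrite mul_rV_lin1 => fu; apply: (bij_inj (phi_bij tt)).
  by rewrite linear0.
apply/row_matrixP => i; rewrite !rowE !mulmxA !mul_rV_lin1 /=.
have /lfunP/(_ (delta_mx 0 i)) := phi_hom a.
by rewrite !comp_lfunE /= !mxrepE.
Qed.

Lemma mxrep_ext X Y : X =1 Y -> rep_iso (mxrep X) (mxrep Y).
Proof.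
move=> XY; have -> : mxrep X = mxrep Y; last exact: rep_iso_refl.
by congr Rep; apply: functional_extensionality_dep => a; rewrite XY.
Qed.

End MxRep.

(** ** Tree modules as matrices *)

Section DsumEval.
Variables (K : fieldType) (I : finType) (V : I -> vectType K).

Lemma dsum_sumE (J : finType) (u : J -> dsum V) i : (\sum_j u j) i = \sum_j u j i.
Proof. exact: (linear_sum (dsum_proj_fun i)). Qed.

Lemma dsum_projE i (u : dsum V) : dsum_proj V i u = u i.
Proof. by rewrite lfunE. Qed.

Lemma dsum_injE i (x : V i) j : dsum_inj V i x j = dfwith (fun k => 0 : V k) x j.
Proof. by rewrite lfunE ffunE. Qed.

End DsumEval.

Section TreeModule.
Variables (K : fieldType) (n g : nat).
Implicit Types (F : {ffun 'I_n -> 'I_n.+1 * 'I_n.+1}) (l : {ffun 'I_n -> 'I_g}).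

Definition tree_mx F l (a : 'I_g) : 'M[K]_n.+1 :=
  \sum_(b | l b == a) delta_mx (F b).1 (F b).2.

Lemma row_tree_mx F l a (u : 'rV[K]_n.+1) j :
  (u *m tree_mx F l a) 0 j = \sum_(b | (l b == a) && ((F b).2 == j)) u 0 (F b).1.
Proof.
rewrite mulmx_sumr summxE big_mkcondr; apply: eq_bigr => b _.
rewrite mxE (bigD1 (F b).1) //= mxE eqxx big1 => [|k kF].
  by rewrite addr0 (eq_sym j); case: eqP; rewrite ?mulr1 ?mulr0.
by rewrite mxE (negbTE kF) mulr0.
Qed.

End TreeModule.

(** The module pushed forward from a tree quiver, in the coordinates given by a
    numbering [h] of the vertices and arrows of that quiver. *)
Section PushforwardMx.
Variables (K : fieldType) (n g : nat) (T : quiver) (f : quiver_hom T (loop_quiver g)).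
Variables (F : {ffun 'I_n -> 'I_n.+1 * 'I_n.+1}) (l : {ffun 'I_n -> 'I_g}).
Variables (h : quiver_hom T (arrows_quiver F)) (hv' : 'I_n.+1 -> vert T).
Hypotheses (hvK : cancel (hom_vert h) hv') (hv'K : cancel hv' (hom_vert h)).
Hypothesis ha_bij : bijective (hom_arr h).
Hypothesis l_h : forall b, l (hom_arr h b) = hom_arr f b.

Fact tt_fiber_subproof (y : vert T) : hom_vert f y == tt.
Proof. by case: (hom_vert f y). Qed.

Definition tt_fiber (y : vert T) : fiber f tt :=
  exist (fun y => hom_vert f y == tt) y (tt_fiber_subproof y).

Lemma tt_fiberK (y : fiber f tt) : tt_fiber (val y) = y.
Proof. exact: val_inj. Qed.

Lemma pushforward_mapE a (u : push_vect f (id_rep K T) tt) y :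
  rmap (pushforward f (id_rep K T)) a u y =
  \sum_(b | (hom_arr f b == a) && (qhead b == val y)) u (tt_fiber (qtail b)).
Proof.
pose A := [pred b | hom_arr f b == a].
rewrite (@big_sub_cond _ _ _ (arr T) A) /= /push_map sum_lfunE.
rewrite dsum_sumE [RHS]big_mkcond; apply: eq_bigr => b _.
rewrite !comp_lfunE dsum_projE dsum_injE id_lfunE.
have -> : (qhead (val b) == val y) = (fiber_head b == y) by [].
have [<- | by_] := eqVneq (fiber_head b) y; last by rewrite dfwith_out.
by rewrite dfwith_in; congr (u _); apply: val_inj.
Qed.

Definition fiber_coord (u : push_vect f (id_rep K T) tt) : 'rV[K]_n.+1 :=
  \row_i u (tt_fiber (hv' i)).

Fact fiber_coord_linear : linear fiber_coord.
Proof. by move=> k u v; apply/rowP => i; rewrite !mxE dsum_addE dsum_scaleE. Qed.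
HB.instance Definition _ :=
  GRing.isLinear.Build K (push_vect f (id_rep K T) tt) 'rV[K]_n.+1 _
    fiber_coord fiber_coord_linear.

Lemma pushforward_tree_mx :
  rep_iso (pushforward f (id_rep K T)) (mxrep (tree_mx K F l)).
Proof.
exists (fun _ => linfun fiber_coord); split=> [[] | a].
  exists (fun r : 'rV[K]_n.+1 =>
    [ffun y : fiber f tt => r 0 (hom_vert h (val y)) : K^o] : dsum _) => [u | r].
    by apply/ffunP => y; rewrite ffunE lfunE mxE hvK tt_fiberK.
  by apply/rowP => i; rewrite lfunE mxE ffunE hv'K.
apply/lfunP => u; apply/rowP => j; rewrite !comp_lfunE mxrepE row_tree_mx !lfunE /=.
rewrite mxE pushforward_mapE [RHS](reindex (hom_arr h)) /=; last exact: onW_bij.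
apply: eq_big => [b | b _].
  rewrite l_h -(hom_head h b : _ = (F _).2) /=; congr (_ && _).
  by rewrite (can2_eq hvK hv'K).
by rewrite mxE -(hom_tail h b : _ = (F _).1) hvK.
Qed.

End PushforwardMx.

Section TreeModuleMx.
Variables (K : fieldType) (n g : nat).
Implicit Types (F : {ffun 'I_n -> 'I_n.+1 * 'I_n.+1}) (l : {ffun 'I_n -> 'I_g}).

(** The source of the pushforward may be taken to be a tree quiver with numbered
    vertices and arrows, which leaves finitely many candidates. *)
Lemma tree_moduleP (M : rep K (loop_quiver g)) :
  tree_module M /\ rdim M = n.+1 <->
  indecomposable M /\
  exists F l, F \in tree_arrows n /\ rep_iso M (mxrep (tree_mx K F l)).
Proof.
split=> [[[M_indec [T [f [T_tree Mf]]]] dM] | [M_indec [F [l [F_tree MF]]]]].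
  split=> //.
  have [m cT] : exists m, #|vert T| = m.+1 by exists #|arr T|; apply: tree_card_arr.
  have [F F_tree [h [[hv' hvK hv'K] ha_bij]]] := tree_quiver_arrows T_tree cT.
  have [ha' haK _] := ha_bij.
  pose l : {ffun 'I_m -> 'I_g} := [ffun i => hom_arr f (ha' i)].
  have l_h b : l (hom_arr h b) = hom_arr f b by rewrite ffunE haK.
  have MF := rep_iso_trans Mf (pushforward_tree_mx K hvK hv'K ha_bij l_h).
  have mn : m = n by apply/succn_inj; rewrite -dM (rep_iso_dim MF) rdim_mxrep.
  by subst m; exists F, l.
split; last by rewrite (rep_iso_dim MF) rdim_mxrep.
split=> //; exists (arrows_quiver F).
exists (@QuiverHom (arrows_quiver F) (loop_quiver g) (fun=> tt) l (fun=> erefl) (fun=> erefl)).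
split; first exact/tree_arrowsP.
apply: rep_iso_trans MF (rep_iso_sym _).
pose h := @QuiverHom (arrows_quiver F) (arrows_quiver F) id id (fun=> erefl) (fun=> erefl).
by apply: (@pushforward_tree_mx _ _ _ _ _ _ _ h id) => //; exists id.
Qed.

(** The arrows of a tree occupy distinct entries, so the matrix units of the
    arrows with a common label do not cancel, in any characteristic. *)
Lemma tree_mx_eq0 F l a : F \in tree_arrows n ->
  (tree_mx K F l a == 0) = (a \notin [set l b | b : 'I_n]).
Proof.
move=> /tree_arrowsP[_ simple _]; apply/eqP/idP => [Fa0 | a_l].
  apply/imsetP => -[b _ ab].
  have := row_tree_mx F l a (delta_mx 0 (F b).1 : 'rV[K]_n.+1) (F b).2.
  rewrite Fa0 mulmx0 mxE (bigD1 b) /= ?ab ?eqxx // big1 => [|c].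
    by rewrite mxE !eqxx addr0 => /esym/eqP; rewrite oner_eq0.
  move=> /andP[/andP[_ /eqP hc] cb]; rewrite mxE /=; case: eqP => // tc.
  by case/eqP: cb; apply: simple; rewrite /= tc hc.
by apply: big1 => b /eqP lb; rewrite -lb imset_f in a_l.
Qed.

End TreeModuleMx.
(** * Supports *)

Section Transfer.
Variables (K : fieldType) (i g : nat) (h : 'I_i -> 'I_g).
Hypothesis h_inj : injective h.

Definition res_rep (V : rep K (loop_quiver g)) : rep K (loop_quiver i) :=
  @Rep K (loop_quiver i) (rvect V) (fun b => rmap V (h b)).

Definition ext_rep (V : rep K (loop_quiver i)) : rep K (loop_quiver g) :=
  @Rep K (loop_quiver g) (rvect V)
    (fun a => if [pick b | h b == a] is Some b then rmap V b else 0).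

Lemma res_rep_iso V W : rep_iso V W -> rep_iso (res_rep V) (res_rep W).
Proof. by move=> [phi [phi_bij phi_hom]]; exists phi; split=> // b; apply: phi_hom. Qed.

Lemma ext_rep_iso V W : rep_iso V W -> rep_iso (ext_rep V) (ext_rep W).
Proof.
move=> [phi [phi_bij phi_hom]]; exists phi; split=> // a /=.
by case: pickP => [b _|_]; [apply: phi_hom | rewrite comp_lfun0l comp_lfun0r].
Qed.

Lemma res_repK (V : rep K (loop_quiver g)) : (forall a, a \notin codom h -> rmap V a = 0) ->
  rep_iso V (ext_rep (res_rep V)).
Proof.
move=> V0; exists (fun x => \1%VF); split=> [x | a].
  by exists \1%VF => u; rewrite !id_lfunE.
rewrite comp_lfun1l comp_lfun1r /=.
case: pickP => [b /eqP <- // | hN]; apply: V0.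
by apply/codomP => -[b ab]; have := hN b; rewrite -ab eqxx.
Qed.

Lemma ext_repK V : rep_iso V (res_rep (ext_rep V)).
Proof.
exists (fun x => \1%VF); split=> [x | b].
  by exists \1%VF => u; rewrite !id_lfunE.
rewrite comp_lfun1l comp_lfun1r /=.
by case: pickP => [c /eqP/h_inj -> // | /(_ b)]; rewrite eqxx.
Qed.

(** Restriction and extension by zero commute with direct sums, so that they
    carry a decomposition of a representation to one of the resulting
    representation. *)
Lemma res_rep_indec V : indecomposable (res_rep V) -> indecomposable V.
Proof.
by move=> [V0 V_indec]; split=> // A B /res_rep_iso/(V_indec (res_rep A) (res_rep B)).
Qed.

Lemma ext_rep_indec V : indecomposable (ext_rep V) -> indecomposable V.
Proof.
move=> [V0 V_indec]; split=> // A B /ext_rep_iso VAB.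
apply: (V_indec (ext_rep A) (ext_rep B)); apply: rep_iso_trans VAB _.
exists (fun x => \1%VF); split=> [x | a].
  by exists \1%VF => u; rewrite !id_lfunE.
rewrite comp_lfun1l comp_lfun1r /=; case: pickP => // _.
by apply/lfunP => u; rewrite lfunE lfunE /= /pair_map_fun !lfunE.
Qed.

End Transfer.

Section Sincere.
Variables (K : fieldType) (n : nat).
Implicit Types (F : {ffun 'I_n -> 'I_n.+1 * 'I_n.+1}).

Definition sincere_tree_module (i : nat) (M : rep K (loop_quiver i)) : Prop :=
  (tree_module M /\ rdim M = n.+1) /\ forall a, rmap M a != 0.

Lemma sincere_tree_module_iso i (V W : rep K (loop_quiver i)) :
  rep_iso V W -> sincere_tree_module V -> sincere_tree_module W.
Proof.
move=> VW [[V_tree dV] V0]; split.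
  by split; [apply: rep_iso_tree_module VW _ | rewrite -(rep_iso_dim VW)].
move=> a; apply: contraNneq (V0 a) => Wa0; apply/eqP.
exact: rep_iso_map_eq0 (rep_iso_sym VW) Wa0.
Qed.

Lemma sincere_tree_moduleP i (M : rep K (loop_quiver i)) :
  sincere_tree_module M <-> indecomposable M /\
  exists F (l : {ffun 'I_n -> 'I_i}),
    [/\ F \in tree_arrows n, forall a, a \in [set l b | b : 'I_n] &
        rep_iso M (mxrep (tree_mx K F l))].
Proof.
split=> [[/tree_moduleP[M_indec [F [l [F_tree MF]]]] M0]
    | [M_indec [F [l [F_tree l_onto MF]]]]].
  split=> //; exists F, l; split=> // a; apply: contraT => al.
  have /eqP X0 : tree_mx K F l a == 0 by rewrite tree_mx_eq0.
  case/eqP: (M0 a); apply: rep_iso_map_eq0 (rep_iso_sym MF) _.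
  by apply/eqP; rewrite mxrep_eq0 X0.
split; first by apply/tree_moduleP; split=> //; exists F, l.
move=> a; apply/eqP => /(rep_iso_map_eq0 MF)/eqP.
by rewrite mxrep_eq0 tree_mx_eq0 // l_onto.
Qed.

Lemma sincere_tree_module_count i :
  exists c, iso_class_count (@sincere_tree_module i) (@rep_iso K _) c.
Proof.
pose r (Fl : {ffun 'I_n -> 'I_n.+1 * 'I_n.+1} * {ffun 'I_n -> 'I_i}) :=
  mxrep (tree_mx K Fl.1 Fl.2).
apply: (@iso_class_count_exists _ _ _ _ _ _ r).
- exact: rep_iso_sym.
- exact: rep_iso_trans.
- exact: sincere_tree_module_iso.
- by move=> M /sincere_tree_moduleP[_ [F [l [_ _ MF]]]]; exists (F, l).
Qed.

Lemma sincere_tree_module_le i (M : rep K (loop_quiver i)) :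
  sincere_tree_module M -> (i <= n)%N.
Proof.
move=> /sincere_tree_moduleP[_ [F [l [_ l_onto _]]]].
have -> : i = #|[set l b | b : 'I_n]|.
  by rewrite -[LHS](card_ord i); apply: eq_card => a; rewrite l_onto.
by rewrite (leq_trans (leq_imset_card _ _)) // card_ord.
Qed.

Section Transfer.
Variables (i g : nat) (h : 'I_i -> 'I_g).
Hypothesis h_inj : injective h.

Lemma res_mxrep (X : 'I_g -> 'M[K]_n.+1) :
  res_rep h (mxrep X) = mxrep (fun b => X (h b)).
Proof. by []. Qed.

Lemma tree_mx_comp F (l : {ffun 'I_n -> 'I_i}) (l' : {ffun 'I_n -> 'I_g}) b :
  (forall c, l' c = h (l c)) -> tree_mx K F l' (h b) = tree_mx K F l b.
Proof.
by move=> ll'; apply: eq_bigl => c; rewrite ll' (inj_eq h_inj).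
Qed.

Lemma ext_rep_tree (M : rep K (loop_quiver i)) : sincere_tree_module M ->
  tree_module (ext_rep h M) /\ rdim (ext_rep h M) = n.+1.
Proof.
move=> /sincere_tree_moduleP[M_indec [F [l [F_tree _ MF]]]].
apply/tree_moduleP; split.
  apply: (@res_rep_indec _ _ _ h).
  exact: rep_iso_indec (ext_repK h_inj M) M_indec.
pose l' : {ffun 'I_n -> 'I_g} := [ffun b => h (l b)]; exists F, l'; split=> //.
apply: rep_iso_trans (ext_rep_iso _ MF) _.
apply: rep_iso_trans (rep_iso_sym (res_repK (h := h) _)).
  apply: ext_rep_iso; rewrite res_mxrep; apply: mxrep_ext => b.
  by rewrite (@tree_mx_comp _ l) // => c; rewrite ffunE.
move=> a ha; apply/eqP; rewrite mxrep_eq0 tree_mx_eq0 //.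
by apply: contra ha => /imsetP[b _ ->]; rewrite ffunE codom_f.
Qed.

Lemma res_rep_tree (M : rep K (loop_quiver g)) :
    tree_module M /\ rdim M = n.+1 -> (forall a, (a \in codom h) = (rmap M a != 0)) ->
  sincere_tree_module (res_rep h M).
Proof.
move=> M_tree h_supp; have [_ dM] := M_tree.
have /tree_moduleP[M_indec [F [l [F_tree MF]]]] := M_tree.
split; last by move=> b /=; rewrite -h_supp codom_f.
have M0 a : a \notin codom h -> rmap M a = 0 by rewrite h_supp negbK => /eqP.
apply/tree_moduleP; split.
  apply: (@ext_rep_indec _ _ _ h).
  exact: rep_iso_indec (res_repK M0) M_indec.
have l_h b : exists c, l b = h c.
  suff /codomP : l b \in codom h by [].
  rewrite h_supp; apply/eqP => /(rep_iso_map_eq0 MF)/eqP.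
  by rewrite mxrep_eq0 tree_mx_eq0 // imset_f.
have [l' l'P] := fin_all_exists l_h; exists F, [ffun b => l' b]; split=> //.
apply: rep_iso_trans (res_rep_iso h MF) _; rewrite res_mxrep.
by apply: mxrep_ext => b; apply: tree_mx_comp => c; rewrite ffunE l'P.
Qed.

End Transfer.

(** A tree module is the extension by zero of its restriction to its support,
    a sincere tree module, and isomorphic tree modules have the same support. *)
Lemma TM_count_support (c : nat -> nat) g :
    (forall i, iso_class_count (@sincere_tree_module i) (@rep_iso K _) (c i)) ->
  TM_count K g n.+1 (\sum_(S : {set 'I_g}) c #|S|).
Proof.
move=> c_count.
have [s sP] : exists s : forall i, 'I_(c i) -> rep K (loop_quiver i),
    forall i, iso_representatives (@sincere_tree_module i) (@rep_iso K _) (s i).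
  by exists (fun i => projT1 (cid (c_count i))) => i; apply: projT2 (cid (c_count i)).
pose I := {S : {set 'I_g} & 'I_(c #|S|)}.
pose hS (S : {set 'I_g}) : 'I_#|S| -> 'I_g := @enum_val _ (mem S).
have hS_inj S : injective (@hS S) by apply: enum_val_inj.
have hS_codom S a : (a \in codom (@hS S)) = (a \in S).
  apply/codomP/idP => [[b ->] | aS]; first exact: enum_valP.
  by exists (enum_rank_in aS a); rewrite /hS enum_rankK_in.
pose t (k : I) := ext_rep (@hS (tag k)) (s _ (tagged k)).
have t_supp k a : (rmap (t k) a != 0) = (a \in tag k).
  rewrite -hS_codom /= /t; case: k => S j /=; case: pickP => [b /eqP <- | hN].
    by rewrite codom_f; have [sS _ _] := sP #|S|; have [_ ->] := sS j.
  by rewrite eqxx; apply/esym/negbTE/codomP => -[b ab]; have := hN b; rewrite -ab eqxx.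
have -> : (\sum_(S : {set 'I_g}) c #|S| = #|{: I}|)%N.
  rewrite card_tagged sumnE big_map big_enum /=; apply: eq_bigr => S _.
  by rewrite card_ord.
apply: (iso_class_count_fin (s := t)) => [k | k k' kk' | M M_tree].
- by apply: ext_rep_tree => //; have [sS _ _] := sP #|tag k|; apply: sS.
- have supp_eq : tag k = tag k'.
    apply/setP => a; rewrite -!t_supp; congr (~~ _); apply/eqP/eqP.
      exact: rep_iso_map_eq0 kk'.
    exact: rep_iso_map_eq0 (rep_iso_sym kk').
  case: k k' kk' supp_eq => S j [S' j'] /= kk' SS'; subst S'; congr existT.
  have [_ s_inj _] := sP #|S|; apply: s_inj.
  apply: rep_iso_trans (ext_repK (@hS_inj S) _) _.
  apply: rep_iso_trans (res_rep_iso _ kk') _.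
  exact: rep_iso_sym (ext_repK (@hS_inj S) _).
- pose S := [set a | rmap M a != 0].
  have h_supp a : (a \in codom (@hS S)) = (rmap M a != 0) by rewrite hS_codom inE.
  have [_ _ /(_ (res_rep (@hS S) M))[|j Mj]] := sP #|S|; first exact: res_rep_tree.
  exists (existT _ S j); apply: rep_iso_trans (res_repK _) (ext_rep_iso _ Mj).
  by move=> a; rewrite h_supp negbK => /eqP.
Qed.

End Sincere.

(** * Tree modules whose arrows have distinct labels *)

Section Idempotents.
Variables (K : fieldType) (g m : nat) (X : 'I_g -> 'M[K]_m.+1).

(** The projection onto a direct summand is an idempotent endomorphism. *)
Lemma mxrep_indec :
    (forall P : 'M[K]_m.+1, P *m P = P -> (forall a, X a *m P = P *m X a) ->
       P = 0 \/ P = 1%:M) ->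
  indecomposable (mxrep X).
Proof.
move=> idem01; split=> [|A B [phi [phi_bij phi_hom]]]; first by rewrite rdim_mxrep.
pose f := phi tt; have [fK f'K] := bij_lfunK (phi_bij tt).
have {}f'K w : f ((f^-1)%VF w) = w by have /lfunP/(_ w) := f'K; rewrite comp_lfunE id_lfunE.
have {}fK u : (f^-1)%VF (f u) = u by have /lfunP/(_ u) := fK; rewrite comp_lfunE id_lfunE.
have f_hom a u : f (u *m X a) = (rmap A a (f u).1, rmap B a (f u).2).
  have /lfunP/(_ u) := phi_hom a; rewrite !comp_lfunE mxrepE => ->.
  by rewrite lfunE.
pose pr : 'End((rvect A tt * rvect B tt)%type) := pair_map \1%VF 0%VF.
have prE w : pr w = (w.1, 0) by rewrite lfunE /= /pair_map_fun !lfunE.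
pose e := (f^-1 \o pr \o f)%VF.
have eE u : f (e u) = ((f u).1, 0) by rewrite !comp_lfunE f'K prE.
have f_inj := bij_inj (phi_bij tt).
have [] := idem01 (lin1_mx e).
- apply/row_matrixP => i; rewrite !rowE !mulmxA !mul_rV_lin1; apply: f_inj.
  by rewrite -/f !eE.
- move=> a; apply/row_matrixP => i; rewrite !rowE !mulmxA !mul_rV_lin1.
  by apply: f_inj; rewrite -/f eE !f_hom eE /= linear0.
- move=> e0; left; rewrite rdim_loop; apply/eqP; rewrite dimv_eq0; apply/eqP.
  apply/eqP; rewrite -subv0; apply/subvP => x _; rewrite memv0.
  have := eE ((f^-1)%VF (x, 0)); rewrite -mul_rV_lin1 e0 mulmx0 linear0 f'K.
  by case=> /eqP; rewrite eq_sym.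
- move=> e1; right; rewrite rdim_loop; apply/eqP; rewrite dimv_eq0; apply/eqP.
  apply/eqP; rewrite -subv0; apply/subvP => x _; rewrite memv0.
  have := eE ((f^-1)%VF (0, x)); rewrite -mul_rV_lin1 e1 mulmx1 f'K.
  by case=> /eqP.
Qed.

End Idempotents.

Section InjectiveLabels.
Variables (K : fieldType) (n g : nat) (l : {ffun 'I_n -> 'I_g}).
Hypothesis l_inj : injective l.
Implicit Types F : {ffun 'I_n -> 'I_n.+1 * 'I_n.+1}.

Lemma tree_mx_inj F b : tree_mx K F l (l b) = delta_mx (F b).1 (F b).2.
Proof.
rewrite /tree_mx (bigD1 b) //= big1 ?addr0 // => c /andP[/eqP/l_inj ->].
by rewrite eqxx.
Qed.

Lemma delta_mulmxE p m (i j k : 'I_m) (r : 'I_p) (P : 'M[K]_(m, p)) :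
  (delta_mx i j *m P) k r = (k == i)%:R * P j r.
Proof.
rewrite mxE (bigD1 j) //= big1 => [|s sj]; first by rewrite mxE eqxx andbT addr0.
by rewrite mxE (negbTE sj) andbF mul0r.
Qed.

Lemma mulmx_deltaE p m (i j r : 'I_m) (k : 'I_p) (P : 'M[K]_(p, m)) :
  (P *m delta_mx i j) k r = P k i * (r == j)%:R.
Proof.
rewrite mxE (bigD1 i) //= big1 => [|s si]; first by rewrite mxE eqxx addr0.
by rewrite mxE (negbTE si) mulr0.
Qed.

(** An endomorphism [P] has a constant diagonal [z], by connectedness, and its
    entry at [x != y] vanishes unless [x] is only a tail and [y] only a head.
    Such entries do not compose, so [(P - z)^2 = 0]; for an idempotent [P] this
    reads [P = z (2 P - z)], whence [z = z^2], and [P] is [0] or [1]. *)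
Lemma tree_mx_indec F : F \in tree_arrows n -> indecomposable (mxrep (tree_mx K F l)).
Proof.
move=> /tree_arrowsP F_tree; apply: mxrep_indec => P PP PX.
have PE b k r : (k == (F b).1)%:R * P (F b).2 r = P k (F b).1 * (r == (F b).2)%:R.
  by rewrite -delta_mulmxE -mulmx_deltaE -tree_mx_inj PX.
have Pdiag b : P (F b).2 (F b).2 = P (F b).1 (F b).1.
  by have := PE b (F b).1 (F b).2; rewrite !eqxx mulr1 mul1r.
have Phead b r : r != (F b).2 -> P (F b).2 r = 0.
  by move=> /negbTE rb; have := PE b (F b).1 r; rewrite eqxx rb mulr0 mul1r.
have Ptail b k : k != (F b).1 -> P k (F b).1 = 0.
  by move=> /negbTE kb; have := PE b k (F b).2; rewrite eqxx kb mulr1 mul0r => /esym.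
have Pconst x y : P x x = P y y.
  have [_ _ /and3P[_ /forallP/(_ x)/forallP/(_ y) + _]] := F_tree.
  move=> /connectP[p]; elim: p x => [x _ -> //|z p IHp x /=].
  move=> /andP[/existsP[b] xz /IHp/[apply] <-].
  by case/orP: xz => /andP[/eqP <- /eqP <-]; rewrite /= Pdiag.
pose z := P ord0 ord0; pose N := P - z%:M.
have NE x y : N x y = if x == y then 0 else P x y.
  rewrite !mxE; case: eqP => [->|]; last by rewrite subr0.
  by rewrite mulr1n (Pconst y ord0) subrr.
have NN : N *m N = 0.
  apply/matrixP => x y; rewrite !mxE big1 // => w _; rewrite !NE.
  have [_|xw] := eqVneq x w; first by rewrite mul0r.
  have [_|wy] := eqVneq w y; first by rewrite mulr0.
  have [b /orP[]/eqP wE] := tree_vertex_covered F_tree wy; rewrite wE.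
    by rewrite Ptail ?mul0r // -[_.1]wE.
  by rewrite Phead ?mulr0 // eq_sym -[_.2]wE.
have Pz : P = z *: P - (z * z)%:M + z *: P.
  have := NN; rewrite mulmxBl !mulmxBr PP mul_scalar_mx mul_mx_scalar.
  by rewrite mul_scalar_mx scale_scalar_mx => /subr0_eq/eqP; rewrite subr_eq => /eqP.
have zz : z = z * z.
  by have /matrixP/(_ ord0 ord0) := Pz; rewrite !mxE -/z /= mulr1n addrNK.
have [z0|z0] := eqVneq z 0.
  by left; rewrite Pz z0 scale0r mul0r raddf0 subr0 addr0.
right; have z1 : z = 1 by apply: (mulfI z0); rewrite -zz mulr1.
move: Pz; rewrite z1 scale1r mulr1 -addrA => /eqP.
by rewrite -{1}[P]addr0 (inj_eq (addrI P)) eq_sym addrC subr_eq0 => /eqP.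
Qed.

Definition arrow_end F (e : 'I_n * bool) := if e.2 then (F e.1).1 else (F e.1).2.

(** How the ends of two arrows meet is visible on their matrix units: head to
    tail, through their product being nonzero; tail to tail, through the row
    vectors that they kill; head to head, through the column vectors. *)
Lemma arrow_end_iso F F' e1 e2 :
    rep_iso (mxrep (tree_mx K F l)) (mxrep (tree_mx K F' l)) ->
  arrow_end F e1 = arrow_end F e2 -> arrow_end F' e1 = arrow_end F' e2.
Proof.
move=> /mxrep_iso[P P_unit].
pose X F b : 'M[K]_n.+1 := delta_mx (F b).1 (F b).2.
move=> XP'; have XP b : X F b *m P = P *m X F' b.
  by rewrite /X -!tree_mx_inj.
have head_tail b c : (F b).2 = (F c).1 -> (F' b).2 = (F' c).1.
  move=> bc; apply/eqP; apply: contraT => bc'.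
  have : P *m (X F' b *m X F' c) = X F b *m X F c *m P.
    by rewrite mulmxA -XP -!mulmxA XP.
  rewrite /X !mul_delta_mx_cond bc eqxx (negbTE bc') mulmx0 mulr1n => /esym.
  move=> /(congr1 (mulmx^~ (invmx P))); rewrite mulmxK // mul0mx.
  by move=> /matrixP/(_ (F b).1 (F c).2)/eqP; rewrite !mxE !eqxx oner_eq0.
have tail_tail b c : (F b).1 = (F c).1 -> (F' b).1 = (F' c).1.
  move=> bc; apply/eqP; apply: contraT => bc'.
  pose u : 'rV[K]_n.+1 := delta_mx 0 (F' c).1.
  have : u *m invmx P *m X F b *m P = 0.
    rewrite -mulmxA XP mulmxA mulmxKV // mul_delta_mx_cond eq_sym (negbTE bc').
    by [].
  move=> /(congr1 (mulmx^~ (invmx P))); rewrite mulmxK // mul0mx => uX0.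
  have uXc0 : u *m invmx P *m X F c = 0.
    apply/rowP => j; rewrite mulmx_deltaE -bc [RHS]mxE.
    by have /rowP/(_ (F b).2) := uX0; rewrite mulmx_deltaE eqxx mulr1 [RHS]mxE => ->;
      rewrite mul0r.
  have : u *m X F' c = 0.
    by rewrite -[X F' c](mulKmx P_unit) -XP !mulmxA uXc0 mul0mx.
  rewrite mul_delta_mx => /rowP/(_ (F' c).2)/eqP.
  by rewrite !mxE !eqxx oner_eq0.
have head_head b c : (F b).2 = (F c).2 -> (F' b).2 = (F' c).2.
  move=> bc; apply/eqP; apply: contraT => bc'.
  pose v : 'cV[K]_n.+1 := delta_mx (F' c).2 0.
  have vX0 : X F b *m (P *m v) = 0.
    by rewrite mulmxA XP -mulmxA mul_delta_mx_cond (negbTE bc') mulmx0.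
  have vXc0 : X F c *m (P *m v) = 0.
    apply/colP => j; rewrite delta_mulmxE -bc [RHS]mxE.
    by have /colP/(_ (F b).1) := vX0; rewrite delta_mulmxE eqxx mul1r [RHS]mxE => ->;
      rewrite mulr0.
  have : X F' c *m v = 0.
    by rewrite -[X F' c](mulKmx P_unit) -XP -!mulmxA vXc0 mulmx0.
  rewrite mul_delta_mx => /colP/(_ (F' c).1)/eqP.
  by rewrite !mxE !eqxx oner_eq0.
case: e1 e2 => [b []] [c []]; rewrite /arrow_end /=; auto.
by move/esym/head_tail/esym.
Qed.

Lemma tree_mx_iso F F' : F \in tree_arrows n ->
    rep_iso (mxrep (tree_mx K F l)) (mxrep (tree_mx K F' l)) ->
  F' \in orbit (relabel_action n) (vertex_perms n) F.
Proof.
move=> /tree_arrowsP F_tree FF'; apply/vertex_permsP.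
pose s x := if [pick e | arrow_end F e == x] is Some e then arrow_end F' e else x.
have sE e : s (arrow_end F e) = arrow_end F' e.
  rewrite /s; case: pickP => [e' /eqP|/(_ e)]; last by rewrite eqxx.
  exact: arrow_end_iso.
have coverE x y : x != y -> exists e, x = arrow_end F e.
  move=> xy; have [b /orP[]/eqP ->] := tree_vertex_covered F_tree xy.
    by exists (b, true).
  by exists (b, false).
have s_inj : injective s.
  move=> x y sxy; apply/eqP; apply: contraT => xy.
  have [e1 xE] := coverE x y xy; have yx : y != x by rewrite eq_sym.
  have [e2 yE] := coverE y x yx; case/eqP: xy; rewrite xE yE.
  apply: (arrow_end_iso (rep_iso_sym FF')).
  by rewrite -!sE -xE -yE.
exists (perm s_inj); apply/ffunP => b; rewrite ffunE !permE.
have /= -> := sE (b, true); have /= -> := sE (b, false).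
by rewrite /arrow_end /= -surjective_pairing.
Qed.

End InjectiveLabels.

Section SincereTop.
Variables (K : fieldType) (n : nat).
Implicit Types (F : {ffun 'I_n -> 'I_n.+1 * 'I_n.+1}).

(** Both sides are the same pushforward, in two numberings of the vertices. *)
Lemma tree_mx_vertex_perm g (l : {ffun 'I_n -> 'I_g}) F (p : 'S_n.+1) :
  rep_iso (mxrep (tree_mx K F l))
          (mxrep (tree_mx K [ffun b => (p (F b).1, p (F b).2)] l)).
Proof.
pose f := @QuiverHom (arrows_quiver F) (loop_quiver g)
  (fun=> tt) l (fun=> erefl) (fun=> erefl).
pose h := @QuiverHom (arrows_quiver F) (arrows_quiver F) id id (fun=> erefl) (fun=> erefl).
pose F' : {ffun 'I_n -> 'I_n.+1 * 'I_n.+1} := [ffun b => (p (F b).1, p (F b).2)].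
have ht (b : 'I_n) : p (F b).1 = (F' b).1 by rewrite ffunE.
have hh (b : 'I_n) : p (F b).2 = (F' b).2 by rewrite ffunE.
pose h' := @QuiverHom (arrows_quiver F) (arrows_quiver F') p id ht hh.
apply: (@rep_iso_trans _ _ _ (pushforward f (id_rep K _))).
  by apply/rep_iso_sym/(@pushforward_tree_mx _ _ _ _ f _ _ h id) => //; exists id.
apply: (@pushforward_tree_mx _ _ _ _ f _ _ h' (p^-1)%g) => //; last by exists id.
  exact: permK.
exact: permKV.
Qed.

(** When [n] arrows have [n] loops to cover their labels are distinct, and by
    renumbering the arrows each arrow can be made to carry its own number as a
    label. What then remains is the numbering of the vertices. *)
Lemma sincere_tree_module_count_top :
  iso_class_count (@sincere_tree_module K n n) (@rep_iso K _)
    #|orbit (relabel_action n) (vertex_perms n) @: tree_arrows n|.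
Proof.
pose orbits := orbit (relabel_action n) (vertex_perms n) @: tree_arrows n.
pose I := {A : {set {ffun 'I_n -> 'I_n.+1 * 'I_n.+1}} | A \in orbits}.
pose l1 := [ffun b : 'I_n => b].
have l1_inj : injective l1 by move=> b c; rewrite !ffunE.
have -> : #|orbits| = #|{: I}| by rewrite card_sig; apply: eq_card => A; rewrite inE.
pose s (A : I) := mxrep (tree_mx K (orbit_repr (val A)) l1).
apply: (iso_class_count_fin (s := s)) => [[A A_orb] | [A A_orb] [B B_orb] | M].
- have [A_tree _] := orbit_reprP A_orb.
  apply/sincere_tree_moduleP; split; first exact: tree_mx_indec.
  exists (orbit_repr A), l1; split=> // [a|]; last exact: rep_iso_refl.
  by apply/imsetP; exists a; rewrite ?ffunE.
- have [A_tree AE] := orbit_reprP A_orb; have [B_tree BE] := orbit_reprP B_orb.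
  move=> /(tree_mx_iso l1_inj A_tree)/orbit_eqP AB; apply: val_inj => /=.
  by rewrite AE BE AB.
move=> /sincere_tree_moduleP[_ [F [l [F_tree l_onto MF]]]].
have l_inj : injective l.
  have /imset_injP l_inj : #|l @: 'I_n| == #|'I_n|.
    by apply/eqP/eq_card => a; rewrite l_onto.
  by move=> b c; apply: l_inj.
pose F1 := relabel F (1%g, perm l_inj).
have F1_tree : F1 \in tree_arrows n by rewrite relabel_tree.
have MF1 : rep_iso M (mxrep (tree_mx K F1 l1)).
  apply: rep_iso_trans MF (mxrep_ext _) => a.
  rewrite -(permKV (perm l_inj) a); move: ((perm l_inj)^-1%g a) => b.
  rewrite {1}permE tree_mx_inj //.
  have := tree_mx_inj K l1_inj F1 (perm l_inj b); rewrite ffunE => ->.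
  by rewrite ffunE /= permK !perm1.
have A_orb : orbit (relabel_action n) (vertex_perms n) F1 \in orbits.
  exact: imset_f.
exists (exist (fun A => A \in orbits) _ A_orb); apply: rep_iso_trans MF1 _.
have /vertex_permsP[p pF1] := orbit_repr_mem (vertex_perms n) F1.
by rewrite /s /= pF1; apply: tree_mx_vertex_perm.
Qed.

End SincereTop.

(** * Binomial polynomials *)

Section Binomials.

Lemma prod_XsubC_ord i : \prod_(j < i) ('X - j%:R%:P) =
  \prod_(x <- [seq (j : nat)%:R | j : 'I_i]) ('X - x%:P) :> {poly rat}.
Proof. by rewrite big_map big_enum. Qed.

Lemma size_binomial_poly i : size (binomial_poly i) = i.+1.
Proof.
rewrite size_scale ?invr_eq0 ?pnatr_eq0 -?lt0n ?fact_gt0 // prod_XsubC_ord.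
by rewrite size_prod_XsubC size_map size_enum_ord.
Qed.

Lemma coef_binomial_poly i : (binomial_poly i)`_i = i`!%:R^-1.
Proof.
have := monic_prod_XsubC [seq ((j : nat)%:R : rat) | j : 'I_i] xpredT id.
rewrite monicE lead_coefE size_prod_XsubC size_map size_enum_ord.
by rewrite coefZ prod_XsubC_ord => /eqP ->; rewrite mulr1.
Qed.

Lemma size_binomial_sum d (c : nat -> rat) :
  (size (\sum_(i < d) c i *: binomial_poly i)%R <= d)%N.
Proof.
apply: leq_trans (size_sum _ _ _) _; apply/bigmax_leqP => i _.
by rewrite (leq_trans (size_scale_leq _ _)) // size_binomial_poly.
Qed.

Lemma coef_binomial_sum n (c : nat -> rat) :
  (\sum_(i < n.+1) c i *: binomial_poly i)`_n = c n / n`!%:R.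
Proof.
rewrite big_ord_recr coefD /= nth_default ?size_binomial_sum // add0r.
by rewrite coefZ coef_binomial_poly.
Qed.

Lemma binomial_basis d (B : {poly rat}) : (size B <= d)%N ->
  exists c : nat -> rat, B = \sum_(i < d) c i *: binomial_poly i.
Proof.
elim: d B => [|d IHd] B sB.
  by exists (fun=> 0); rewrite big_ord0; apply/eqP; rewrite -size_poly_leq0.
pose a := B`_d * d`!%:R.
have [|c cE] := IHd (B - a *: binomial_poly d).
  apply/leq_sizeP => j; rewrite leq_eqVlt => /orP[/eqP <- | dj].
    rewrite coefB coefZ coef_binomial_poly mulfK ?subrr //.
    by rewrite pnatr_eq0 -lt0n fact_gt0.
  rewrite nth_default // (leq_trans (size_polyD _ _)) // geq_max (leq_trans sB) //=.
  by rewrite size_polyN (leq_trans (size_scale_leq _ _)) // size_binomial_poly.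
exists (fun i => if i == d then a else c i); rewrite big_ord_recr /= eqxx.
rewrite -[LHS](subrK (a *: binomial_poly d)) cE; congr (_ + _).
by apply: eq_bigr => i _; rewrite ltn_eqF.
Qed.

Lemma sum_card_binomial (n g : nat) (c : nat -> nat) :
    (forall i, (n < i)%N -> c i = 0%N) ->
  (\sum_(S : {set 'I_g}) c #|S| = \sum_(i < n.+1) c i * 'C(g, i))%N.
Proof.
move=> c0; rewrite (bigID (fun S : {set 'I_g} => #|S| < n.+1)%N) /=.
rewrite [X in (_ + X)%N]big1 ?addn0 => [|S]; last by rewrite -leqNgt => /c0.
rewrite (partition_big (fun S : {set 'I_g} => inord #|S| : 'I_n.+1) xpredT) //=.
apply: eq_bigr => i _.
have -> : 'C(g, i) = #|[set S : {set 'I_g} | #|S| == i]| by rewrite card_draws card_ord.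
rewrite mulnC -sum_nat_const [RHS](eq_bigl (fun S : {set 'I_g} => #|S| == i :> nat)) => [|S];
  last by rewrite inE.
apply: eq_big => [S | S /andP[S_lt /eqP <-]]; last by rewrite inordK.
apply/andP/eqP => [[S_lt /eqP <-] | ->]; first by rewrite inordK.
by rewrite ltn_ord inord_val.
Qed.

End Binomials.

(** * Tree quivers up to isomorphism *)

(** Multiplied by [(n+1)!], the two sides of the equation count [tree_arrows]
    through the orbits of all renumberings and through those of the renumberings
    of the vertices. *)
Lemma tree_quiver_representatives (n : nat) :
  exists (m : nat) (Qs : 'I_m -> quiver),
    iso_representatives
      (fun Q : quiver => tree_quiver Q /\ #|vert Q| = n.+1) quiver_iso Qs /\
    \sum_(i < m) n`!%:R / #|quiver_Aut (Qs i)|%:R =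
    #|orbit (relabel_action n) (vertex_perms n) @: tree_arrows n|%:R :> rat.
Proof.
pose orbits := orbit (relabel_action n) setT @: tree_arrows n.
pose I := {A : {set {ffun 'I_n -> 'I_n.+1 * 'I_n.+1}} | A \in orbits}.
pose Qs (A : I) := arrows_quiver (orbit_repr (val A)).
exists #|{: I}|, (fun i => Qs (enum_val i)); split.
  apply: iso_representatives_fin => [[A A_orb] | [A A_orb] [B B_orb] | Q [Q_tree cQ]].
  - have [A_tree _] := orbit_reprP (G := setT_group _) A_orb.
    by split; [apply/tree_arrowsP | rewrite card_ord].
  - have [A_tree AE] := orbit_reprP (G := setT_group _) A_orb.
    have [B_tree BE] := orbit_reprP (G := setT_group _) B_orb.
    by move=> /relabel_quiver_isoP/orbit_eqP AB; apply: val_inj; rewrite /= AE BE AB.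
  have [F F_tree QF] := tree_quiver_arrows Q_tree cQ.
  have A_orb : orbit (relabel_action n) setT F \in orbits by apply: imset_f.
  exists (exist (fun A => A \in orbits) _ A_orb); apply: quiver_iso_trans QF _.
  rewrite /Qs /=; have /= := orbit_repr_mem (setT_group _) F; case/orbitP => p _ <-.
  exact: relabel_quiver_iso.
rewrite -(@big_enum_val _ _ _ _ {: I} (fun A => n`!%:R / #|quiver_Aut (Qs A)|%:R)) /=.
transitivity (\sum_(A in orbits)
    n`!%:R / #|quiver_Aut (arrows_quiver (orbit_repr A))|%:R : rat).
  by rewrite [RHS]big_sub; apply: eq_bigl.
have fact_neq0 : (n.+1)`!%:R != 0 :> rat by rewrite pnatr_eq0 -lt0n fact_gt0.
apply: (mulIf fact_neq0); rewrite -natrM -card_tree_arrows_free -card_tree_arrows_Aut.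
rewrite mulr_suml; apply: eq_bigr => A _.
by rewrite natrM mulrC mulrA.
Qed.

Theorem theorem3p5 (K : fieldType) (d : nat) (d_ge1 : (1 <= d)%N) :
  exists (P : {poly rat}) (c : nat -> rat),
    (* TM_{S_g}(d), as a function of g, is a polynomial of degree d - 1 *)
    [/\ forall g : nat, exists2 n : nat, TM_count K g d n & P.[g%:R] = n%:R,
        size P = d,
    (* its coordinates in the binomial basis and its leading term *)
        P = \sum_(i < d) c i *: binomial_poly i,
        c d.-1 = (2 ^ d.-1 * #|labeled_trees d|)%:R / d%:R /\
        (exists (m : nat) (Qs : 'I_m -> quiver),
           iso_representatives
             (fun Q : quiver => tree_quiver Q /\ #|vert Q| = d) quiver_iso Qs /\
           c d.-1 = \sum_(i < m) (d.-1)`!%:R / #|quiver_Aut (Qs i)|%:R)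
    (* A_{S_g}(d, 1) has the same leading term *)
      & Helleloid_Rodriguez_Villegas d ->
        forall A : nat -> {poly int}, (forall g, is_Kac_polynomial g d (A g)) ->
        exists c' : nat -> rat,
          (forall g : nat,
             (A g).[1]%:~R = (\sum_(i < d) c' i *: binomial_poly i).[g%:R]) /\
          c' d.-1 = c d.-1].
Proof.
case: d d_ge1 => // n _ /=.
pose cn i := projT1 (cid (sincere_tree_module_count K n i)).
have cn_count i : iso_class_count (@sincere_tree_module K n i) (@rep_iso K _) (cn i).
  exact: projT2 (cid (sincere_tree_module_count K n i)).
have cn0 i : (n < i)%N -> cn i = 0%N.
  move=> ni; apply/eqP; rewrite -leqn0 leqNgt; apply/negP => ci.
  have [s [sP _ _]] := cn_count i.
  by have := sincere_tree_module_le (sP (Ordinal ci)); rewrite leqNgt ni.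
have cn_orbits : cn n = #|orbit (relabel_action n) (vertex_perms n) @: tree_arrows n|.
  apply: iso_class_count_uniq (cn_count n) (sincere_tree_module_count_top K n).
    exact: rep_iso_sym.
  exact: rep_iso_trans.
have fact_neq0 m : m`!%:R != 0 :> rat by rewrite pnatr_eq0 -lt0n fact_gt0.
have cn_trees : (cn n)%:R = (2 ^ n * #|labeled_trees n.+1|)%:R / n.+1%:R :> rat.
  apply: (mulIf (fact_neq0 n.+1)); rewrite -natrM cn_orbits -card_tree_arrows_free.
  rewrite card_tree_arrows factS natrM [(n.+1 * _)%:R]natrM mulrA divfK ?pnatr_eq0 //.
  by rewrite -!natrM mulnAC.
pose c i : rat := (cn i)%:R.
have cn_neq0 : c n != 0.
  rewrite /c cn_trees mulf_neq0 ?invr_eq0 ?pnatr_eq0 //.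
  by rewrite -lt0n muln_gt0 expn_gt0 labeled_trees_gt0.
exists (\sum_(i < n.+1) c i *: binomial_poly i), c; split=> //.
- move=> g; exists (\sum_(S : {set 'I_g}) cn #|S|)%N; first exact: TM_count_support.
  rewrite (sum_card_binomial g cn0) horner_sum natr_sum.
  by apply: eq_bigr => i _; rewrite hornerZ binomial_polyE natrM.
- apply/eqP; rewrite eqn_leq size_binomial_sum ltnNge; apply/negP => /leq_sizeP/(_ n).
  by move=> /(_ (leqnn n))/eqP; rewrite coef_binomial_sum mulf_eq0 invr_eq0
       (negbTE cn_neq0) (negbTE (fact_neq0 n)).
- split=> //; have [m [Qs [Qs_rep QsE]]] := tree_quiver_representatives n.
  by exists m, Qs; split=> //; rewrite QsE /c cn_orbits.
move=> HRV A A_Kac; have [B [BE sB lB]] := HRV A A_Kac.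
have [|c' c'E] := @binomial_basis n.+1 B; first by rewrite sB.
exists c'; split=> [g|]; first by rewrite -BE c'E.
have : B`_n = lead_coef B by rewrite lead_coefE sB.
rewrite {1}c'E coef_binomial_sum lB => /(congr1 ( *%R^~ n`!%:R)); rewrite divfK // => ->.
by rewrite /c cn_trees [X in _ / X%:R * _]factS [X in _ / X * _]natrM invfM mulrA divfK.
Qed.
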